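(* Let $(P,\omega)$ be a finite labeled poset. Then \[K_{(P,\omega)}(\mathbf{x})=\sum_{f^*}\operatorname{sign}(f^* )\,\psi_{\mathrm{wt}(f^* )},\] where the sum ranges over all (distinct) pointed $(P,\omega)$-partitions $f^*$.
   Context: A labeled poset $(P,\omega)$ is a finite poset $P$ of size $n$ with a bijection $\omega\colon P\to[n]$. A $(P,\omega)$-partition is a map $\theta\colon P\to\mathbb{Z}^+$ with $\theta(x)\le\theta(y)$ if $x\preceq y$, and $\theta(x)<\theta(y)$ if $x\preceq y$ and $\omega(x)>\omega(y)$; $K_{(P,\omega)}(\mathbf{x})=\sum_\theta x_1^{|\theta^{-1}(1)|}x_2^{|\theta^{-1}(2)|}\cdots$ over all $(P,\omega)$-partitions. Quasisymmetric power sums: for a composition $\alpha=(\alpha_1,\dots,\alpha_l)$ let $\pi(\alpha)=\prod_{i=1}^{l}(\alpha_1+\cdots+\alpha_i)$; if $\alpha$ refines $\beta$ (i.e. $\beta$ is obtained by summing consecutive blocks of parts of $\alpha$), let $\alpha^{(i)}$ be the composition of parts of $\alpha$ summing to $\beta_i$ and $\pi(\alpha,\beta)=\prod_i\pi(\alpha^{(i)})$. With $M_\beta=\sum_{i_1<\dots<i_k}x_{i_1}^{\beta_1}\cdots x_{i_k}^{\beta_k}$ the monomial quasisymmetric functions, set $\psi_\alpha=\sum_{\beta}\frac{1}{\pi(\alpha,\beta)}M_\beta$, summed over all coarsenings $\beta$ of $\alpha$. Enriched partitions: let $\mathbf{P'}$ be the nonzero integers totally ordered by $-1<1<-2<2<\cdots$;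 for $k\in\mathbf{P'}$, $|k|$ is its absolute value, and $k<0$ means $k$ is a negative integer. An enriched $(P,\omega)$-partition is a map $f\colon P\to\mathbf{P'}$ such that $|f|$ is surjective onto $[k]$ for some $k$ and, whenever $x$ is covered by $y$: (i) $f(x)\le f(y)$ in $\mathbf{P'}$; (ii) if $|f(x)|=|f(y)|$ and $\omega(x)<\omega(y)$ then $f(y)>0$; (iii) if $|f(x)|=|f(y)|$ and $\omega(x)>\omega(y)$ then $f(x)<0$. An element $x$ is ambiguous with respect to $f$ if the map obtained from $f$ by replacing $f(x)$ with $-f(x)$ is still an enriched $(P,\omega)$-partition. Introduce new symbols $i^*$ ($i\ge1$) with $|i^*|=i$. The starred $(P,\omega)$-partition of $f$ is $f^*(x)=|f(x)|^*$ if $x$ is ambiguous and $f^*(x)=f(x)$ otherwise. Such $f^*$ is pointed if for each $i\in[k]$ exactly one element $x$ has $f^*(x)=i^*$. Its sign is $\operatorname{sign}(f^* )=(-1)^{|\{x: f^*(x)\text{ is a negative integer}\}|}$, and its weight is $\mathrm{wt}(f^* )=(b_1,\dots,b_k)$ where $b_i=|\{x:|f^*(x)|=i\}|$. *)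

(* Defs.v *)
From HB Require Import structures.
From mathcomp Require Import all_boot all_order all_algebra finmap.
From mathcomp Require Import mathcomp_extra boolp classical_sets functions.
From mathcomp Require Import cardinality fsbigop.

Set Implicit Arguments.
Unset Strict Implicit.
Unset Printing Implicit Defensive.

Import Order.TTheory GRing.Theory Num.Theory.
Local Open Scope classical_set_scope.
Local Open Scope ring_scope.

(* A monomial is its finitely supported exponent vector; the variables are
   x_1, x_2, ..., so the index 0 never occurs in the series below.  A formal
   power series over rat is its coefficient function. *)
Notation monomial := {fsfun nat -> nat with 0%N}.
Notation fps := (monomial -> rat^o).

(* The sum of the monomials e t for t in A.  The set A is usually infinite, but
   for every m only finitely many t satisfy e t = m
   (see finite_fiber_content and finite_fiber_monom below). *)
Definition gen_series (T : choiceType) (A : set T) (e : T -> monomial) : fps :=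
  fun m => \sum_(t \in A) ((e t == m)%:R : rat).

Section LabeledPoset.
Variables (d : Order.disp_t) (P : finPOrderType d) (omega : P -> 'I_#|P|).

Definition Pomega_partition (theta : {ffun P -> nat}) : Prop :=
  (forall x, (0 < theta x)%N) /\
  (forall x y, (x <= y)%O ->
     (theta x <= theta y)%N /\
     ((omega y < omega x)%N -> (theta x < theta y)%N)).

Definition content (theta : {ffun P -> nat}) : monomial :=
  [fsfun i in [fset theta x | x : P]%fset => #|[set x | theta x == i]%SET|].

Definition KP : fps := gen_series [set theta | Pomega_partition theta] content.

End LabeledPoset.

Definition is_composition (a : seq nat) : bool := all (leq 1) a.

(* x_{s_1}^{b_1} x_{s_2}^{b_2} ... *)
Definition monom_of (b s : seq nat) : monomial :=
  [fsfun i in [fset j | j in s]%fset => (\sum_(p <- zip s b | p.1 == i) p.2)%N].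

Definition monomial_qsym (b : seq nat) : fps :=
  gen_series
    [set s : seq nat | size s = size b /\ sorted ltn s /\ all (leq 1) s]
    (monom_of b).

Definition partial_sum (a : seq nat) (i : nat) : nat := sumn (take i a).

Definition pi_comp (a : seq nat) : nat :=
  (\prod_(0 <= i < size a) partial_sum a i.+1)%N.

Definition coarsening (a b : seq nat) : Prop :=
  exists blocks : seq (seq nat),
    [/\ all (fun c => c != [::]) blocks, flatten blocks = a &
        [seq sumn c | c <- blocks] = b].

(* The (i+1)-st block a^(i+1) of a, read off from the partial sums: the part
   a_(j+1) belongs to it iff b_1 + .. + b_i < a_1 + .. + a_(j+1) <=
   b_1 + .. + b_(i+1).  See blocks_coarsening below. *)
Definition block (a b : seq nat) (i : nat) : seq nat :=
  mask [seq (partial_sum b i < partial_sum a j.+1 <= partial_sum b i.+1)%N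
       | j <- iota 0 (size a)] a.

Definition pi_pair (a b : seq nat) : nat :=
  (\prod_(0 <= i < size b) pi_comp (block a b i))%N.

Definition psi (a : seq nat) : fps :=
  \sum_(b \in [set b | coarsening a b])
    ((pi_pair a b)%:R^-1 : rat) *: monomial_qsym b.

(* The order -1 < 1 < -2 < 2 < ... on the nonzero integers. *)
Definition leP' (a b : int) : bool :=
  (`|a| < `|b|)%N || ((`|a| == `|b|)%N && (a <= b)).

(* inl a is the integer a, and inr i is the symbol i^*. *)
Notation starred := (int + nat)%type.

Definition abs_starred (s : starred) : nat :=
  match s with inl a => `|a|%N | inr i => i end.

Definition neg_starred (s : starred) : bool :=
  if s is inl a then a < 0 else false.

Section Enriched.
Variables (d : Order.disp_t) (P : finPOrderType d) (omega : P -> 'I_#|P|).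

Definition covered_by (x y : P) : Prop :=
  (x < y)%O /\ forall z : P, ~ ((x < z)%O /\ (z < y)%O).

Definition enriched_partition (f : {ffun P -> int}) : Prop :=
  [/\ forall x, f x != 0,
      exists k : nat, forall i : nat,
        (1 <= i <= k)%N <-> exists x, `|f x|%N = i &
      forall x y, covered_by x y ->
        [/\ leP' (f x) (f y),
            `|f x|%N = `|f y|%N -> (omega x < omega y)%N -> 0 < f y &
            `|f x|%N = `|f y|%N -> (omega y < omega x)%N -> f x < 0]].

Definition flip_at (f : {ffun P -> int}) (x : P) : {ffun P -> int} :=
  [ffun y => if y == x then - f y else f y].

Definition ambiguous (f : {ffun P -> int}) (x : P) : Prop :=
  enriched_partition (flip_at f x).

Definition starred_of (f : {ffun P -> int}) : {ffun P -> starred} :=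
  [ffun x => if `[< ambiguous f x >] then inr `|f x|%N else inl (f x)].

(* For a starred partition g of f, this is the k with |f| onto [k]. *)
Definition max_abs (g : {ffun P -> starred}) : nat :=
  (\max_(x : P) abs_starred (g x))%N.

Definition starred_partition (g : {ffun P -> starred}) : Prop :=
  exists2 f, enriched_partition f & g = starred_of f.

Definition pointed_partition (g : {ffun P -> starred}) : Prop :=
  starred_partition g /\
  forall i, (1 <= i <= max_abs g)%N -> exists! x, g x = inr i.

Definition sign (g : {ffun P -> starred}) : rat :=
  (-1) ^+ #|[set x | neg_starred (g x)]%SET|.

Definition wt (g : {ffun P -> starred}) : seq nat :=
  [seq #|[set x | abs_starred (g x) == i]%SET| | i <- iota 1 (max_abs g)].

End Enriched.


(* \sum_(i \in A) F i is 0 by convention when its support is infinite; the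
   lemmas below show that this never happens for the sums used here. *)

Lemma finite_ffun_fset (D : finType) (T : choiceType) (S : {fset T}) :
  finite_set [set f : {ffun D -> T} | forall x, f x \in S].
Proof.
apply: (@sub_finite_set _ _
  ((fun h : {ffun D -> S} => [ffun x => val (h x)] : {ffun D -> T}) @` setT)).
  move=> f /= fS; exists [ffun x => [` fS x]%fset] => //.
  by apply/ffunP => x; rewrite !ffunE.
exact/finite_image/finite_finset.
Qed.

Lemma finite_seq_bounded (n N : nat) :
  finite_set [set s : seq nat | (size s <= n)%N /\ all (ltn^~ N) s].
Proof.
apply: (@sub_finite_set _ _ ((fun p : 'I_n.+1 * n.-tuple 'I_N.+1 =>
   take p.1 [seq val i | i <- p.2]) @` setT)); last first.
  exact/finite_image/finite_finset.
move=> s /= [sn /allP sN].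
pose t := [tuple (inord (nth 0%N s i) : 'I_N.+1) | i < n].
exists (inord (size s), t) => //=.
have st : size [seq val i | i <- t] = n by rewrite size_map size_tuple.
rewrite inordK ?ltnS//.
apply: (@eq_from_nth _ 0%N); first by rewrite size_takel ?st.
rewrite size_takel ?st// => i si; rewrite nth_take//.
have ilt : (i < n)%N := leq_trans si sn.
rewrite (nth_map ord0) ?size_tuple ?card_ord//.
rewrite -[i in nth _ t i]/(val (Ordinal ilt)) -tnth_nth tnth_mktuple inordK//.
by rewrite ltnS ltnW//; apply: sN; apply: mem_nth.
Qed.

Lemma contentE (d : Order.disp_t) (P : finPOrderType d)
  (theta : {ffun P -> nat}) i : content theta i = #|[set x | theta x == i]%SET|.
Proof.
rewrite /content fsfunE; case: ifPn => // /negP ni.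
apply/esym/eqP; rewrite cards_eq0; apply/eqP/setP => x; rewrite !inE.
by apply/negP => /eqP xi; apply: ni; rewrite -xi; apply/imfsetP; exists x.
Qed.

Lemma finite_fiber_content (d : Order.disp_t) (P : finPOrderType d)
  (m : monomial) : finite_set [set theta : {ffun P -> nat} | content theta = m].
Proof.
apply: sub_finite_set (finite_ffun_fset P (finsupp m)) => theta /= <- x.
by rewrite mem_finsupp contentE -lt0n; apply/card_gt0P; exists x; rewrite inE.
Qed.

Lemma monom_ofE (b s : seq nat) i :
  monom_of b s i = (\sum_(p <- zip s b | p.1 == i) p.2)%N.
Proof.
rewrite /monom_of fsfunE; case: ifPn => //; rewrite !inE /= => ni.
apply/esym; rewrite big_seq_cond big1// => -[j c] /andP[/= jc /eqP ji].
move: ni; rewrite -ji; suff -> : j \in s by [].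
elim: s b jc => [|h s IH] [|k b]//=; rewrite in_cons => /orP[/eqP[-> _]|/IH].
  by rewrite mem_head.
by rewrite in_cons orbC => ->.
Qed.

Lemma finite_fiber_monom (b : seq nat) (m : monomial) : is_composition b ->
  finite_set [set s : seq nat | size s = size b /\ monom_of b s = m].
Proof.
move=> bpos; pose N := (\max_(i <- finsupp m) i).+1.
apply: sub_finite_set (finite_seq_bounded (size b) N) => s /= [sb sm].
split; first by rewrite sb.
apply/allP => i /= si; rewrite ltnS.
suff im : i \in finsupp m by rewrite (big_rem i)//= leq_maxl.
rewrite mem_finsupp -sm monom_ofE -lt0n; move/allP: bpos => bpos.
have isz : (index i s < size b)%N by rewrite -sb index_mem.
have mz : (i, nth 0%N b (index i s)) \in zip s b.
  rewrite -[X in (X, _)](nth_index 0%N si) -nth_zip//; apply: mem_nth.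
  by rewrite size_zip sb minnn.
rewrite (big_rem _ mz)/= eqxx ltn_addr//; exact/bpos/mem_nth.
Qed.

Lemma finite_coarsenings (a : seq nat) : finite_set [set b | coarsening a b].
Proof.
apply: sub_finite_set (finite_seq_bounded (size a) (sumn a).+1).
move=> _ /= [bl [ne <- <-]]; split.
  elim: bl ne => //= c bl IH /andP[c0 /IH]; rewrite size_cat.
  by case: c c0 => //= ? c _ h; rewrite addSn ltnS (leq_trans h)// leq_addl.
apply/allP => _ /mapP[c cbl ->] /=; rewrite ltnS.
elim: bl cbl {ne} => //= e bl IH; rewrite in_cons sumn_cat => /orP[/eqP ->|/IH h].
  exact: leq_addr.
exact: leq_trans h (leq_addl _ _).
Qed.

Lemma coarsening_composition (a b : seq nat) :
  is_composition a -> coarsening a b -> is_composition b.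
Proof.
move=> + [bl [ne E1 <-]]; rewrite -{}E1 /is_composition.
elim: bl ne => //= c bl IH /andP[c0 ne]; rewrite all_cat => /andP[cp /(IH ne) ->].
case: c c0 cp => //= h c _ /andP[h0 _]; rewrite andbT.
exact: leq_trans h0 (leq_addr _ _).
Qed.

Lemma blocks_coarsening (a : seq nat) (bl : seq (seq nat)) :
  is_composition a -> all (fun c => c != [::]) bl -> flatten bl = a ->
  [seq block a [seq sumn c | c <- bl] i | i <- iota 0 (size bl)] = bl.
Proof.
move=> ap ne E; move: ap ne; rewrite -{}E.
elim: bl => //= c bl IH; rewrite /is_composition all_cat.
move=> /andP[cp bp] /andP[c0 ne].
have psl u v j : (j <= size u)%N -> partial_sum (u ++ v) j = partial_sum u j.
  by rewrite /partial_sum => ju; rewrite takel_cat.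
have psr u v j :
    partial_sum (u ++ v) (size u + j) = (sumn u + partial_sum v j)%N.
  by rewrite /partial_sum take_cat ltnNge leq_addr/= addKn sumn_cat.
have ps_le u j : (partial_sum u j <= sumn u)%N.
  by rewrite -{2}(cat_take_drop j u) sumn_cat leq_addr.
have ps_pos u j : all (leq 1) u -> (j < size u)%N -> (0 < partial_sum u j.+1)%N.
  case: u => //= h u /andP[h0 _] _.
  by rewrite /partial_sum /= (leq_trans h0)// leq_addr.
have ps0 u : partial_sum u 0 = 0%N by rewrite /partial_sum take0.
have psS e u j : partial_sum (e :: u) j.+1 = (e + partial_sum u j)%N by [].
have split_mask (p : nat -> bool) (u v : seq nat) :
    mask [seq p j | j <- iota 0 (size (u ++ v))] (u ++ v) =
    mask [seq p j | j <- iota 0 (size u)] u ++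
    mask [seq p (size u + j)%N | j <- iota 0 (size v)] v.
  rewrite size_cat iotaD map_cat mask_cat ?size_map ?size_iota//.
  congr (_ ++ mask _ _).
  by rewrite -[in LHS](addn0 (0 + _)%N) add0n iotaDl -map_comp.
have maskF (p : nat -> bool) (u : seq nat) :
    (forall j, (j < size u)%N -> p j = false) ->
    mask [seq p j | j <- iota 0 (size u)] u = [::].
  move=> pF; rewrite (_ : map _ _ = nseq (size u) false) ?mask_false//.
  apply: (@eq_from_nth _ false); rewrite size_map size_iota ?size_nseq// => j ju.
  by rewrite (nth_map 0%N) ?size_iota// nth_iota// nth_nseq ju pF.
have maskT (p : nat -> bool) (u : seq nat) :
    (forall j, (j < size u)%N -> p j) ->
    mask [seq p j | j <- iota 0 (size u)] u = u.
  move=> pT; rewrite (_ : map _ _ = nseq (size u) true) ?mask_true//.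
  apply: (@eq_from_nth _ false); rewrite size_map size_iota ?size_nseq// => j ju.
  by rewrite (nth_map 0%N) ?size_iota// nth_iota// nth_nseq ju pT.
congr (_ :: _).
  rewrite /block split_mask maskT ?maskF ?cats0// => j js.
    rewrite -addnS psr psS leq_add2l !ps0 [(_ <= 0)%N]leqNgt.
    by rewrite ps_pos ?andbF.
  by rewrite psl// psS !ps0 addn0 ps_pos ?ps_le.
rewrite -[in RHS](IH bp ne) -[1%N]addn0 iotaDl -map_comp; apply: eq_map => i /=.
rewrite add1n /block split_mask maskF ?cat0s => [|j js].
  congr mask; apply: eq_map => j.
  by rewrite -addnS psr !psS ltn_add2l leq_add2l.
by rewrite psl// psS ltnNge (leq_trans (ps_le _ _)) ?leq_addr.
Qed.

Lemma finite_enriched (d : Order.disp_t) (P : finPOrderType d)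
  (omega : P -> 'I_#|P|) :
  finite_set [set f : {ffun P -> int} | enriched_partition omega f].
Proof.
pose S : {fset int} := [fset (- (i%:Z)) | i in iota 0 #|P|.+1]%fset.
pose S' : {fset int} := [fset (i%:Z) | i in iota 0 #|P|.+1]%fset.
apply: sub_finite_set (finite_ffun_fset P (S `|` S')%fset).
move=> f /= [_ [k fk] _] x.
have kP : (k <= #|P|)%N.
  rewrite -(size_iota 1 k) cardE -(size_map (fun x => `|f x|%N)).
  apply: uniq_leq_size; first exact: iota_uniq.
  move=> i; rewrite mem_iota add1n ltnS => /fk[y yi].
  by apply/mapP; exists y; rewrite ?mem_enum.
have /andP[_ fxk] : (1 <= `|f x| <= k)%N by apply/fk; exists x.
have fxP : `|f x|%N \in iota 0 #|P|.+1.
  by rewrite mem_iota add0n ltnS (leq_trans fxk kP).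
rewrite inE; apply/orP; case: (leP 0 (f x)) => f0.
  right; apply/imfsetP; exists `|f x|%N => //.
  by rewrite gez0_abs.
left; apply/imfsetP; exists `|f x|%N => //.
by rewrite ltz0_abs// opprK.
Qed.

Lemma finite_pointed (d : Order.disp_t) (P : finPOrderType d)
  (omega : P -> 'I_#|P|) :
  finite_set [set g : {ffun P -> starred} | pointed_partition omega g].
Proof.
apply: sub_finite_set (finite_image (starred_of omega) (finite_enriched omega)).
by move=> g /= [[f ef ->] _]; exists f.
Qed.

(* Main.v *)
(** Both sides are products in the incidence algebra of the order ideals of [P],
    graded by the size of [A \ B].  Let [zeta (B, A)] be 1 when [omega] is
    increasing on [A \ B].  The coefficient of [M_b] in [K] is the
    [(empty, P)] entry of the product of the [zeta_(b_i)], and the signed number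
    of pointed partitions of weight [a] is that of the product of the
    [eta_(a_i)], where [eta (B, A)] is the signed number of one-level pointed
    partitions of [A \ B].  In a one-level enriched partition the element with
    the least label is always ambiguous, and flipping an ambiguous element does
    not change which elements are ambiguous; sign-reversing flips then give the
    noncommutative Newton identities
    [n zeta_n = sum_j zeta_(n-j) eta_j].  Solving them yields
    [zeta_n = sum_a eta_a / pi(a)] over the compositions [a] of [n], which is the
    definition of [psi]. *)

Require Import Defs.
From mathcomp Require Import all_boot all_order all_algebra finmap.
From mathcomp Require Import boolp classical_sets functions cardinality fsbigop.
From mathcomp Require Import fintype finset.
Import Order.TTheory GRing.Theory Num.Theory.

Set Implicit Arguments.
Unset Strict Implicit.
Unset Printing Implicit Defensive.

Local Open Scope ring_scope.

(** * Sign-reversing involutions on subsets *)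

Section Toggle.
Variable T : finType.
Implicit Types (N : {set T}) (x y : T).

(** On sets of negative elements this is the sign flip [flip_at]. *)
Definition toggle N x : {set T} := if x \in N then N :\ x else x |: N.

Lemma in_toggle N x y : (y \in toggle N x) = (y == x) (+) (y \in N).
Proof.
rewrite /toggle; case: ifP => xN; rewrite !inE; case: eqP => //= ->.
  by rewrite xN.
by rewrite xN.
Qed.

Lemma toggleK x : involutive (toggle^~ x).
Proof. by move=> N; apply/setP => y; rewrite !in_toggle addbA addbb. Qed.

Lemma toggle_sub (D : {set T}) N x :
  x \in D -> (toggle N x \subset D) = (N \subset D).
Proof.
move=> xD; apply/subsetP/subsetP => h y; have := h y;
  rewrite in_toggle; case: eqP => [-> //|_] /=; exact.
Qed.

Lemma sign_toggle N x : (-1) ^+ #|toggle N x| = - (-1) ^+ #|N| :> rat.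
Proof.
rewrite /toggle; case: ifP => xN.
  by rewrite [in RHS](cardsD1 x N) xN exprS mulN1r opprK.
by rewrite cardsU1 xN exprS mulN1r.
Qed.

(** Reindexing by [t] shows that the sum is its own opposite; at a fixed point of [t] the last
    hypothesis makes [F] vanish. *)
Lemma sum_involution0 (Q : pred T) (t : T -> T) (F : T -> rat) :
  (forall i, Q i -> Q (t i)) -> (forall i, Q i -> t (t i) = i) ->
  (forall i, Q i -> F (t i) = - F i) -> \sum_(i | Q i) F i = 0.
Proof.
move=> Qt tK Ft.
have E : \sum_(i | Q i) F i = - \sum_(i | Q i) F i.
  rewrite [LHS](reindex_onto t t) //= -sumrN; apply: eq_big => [i|i].
    apply/andP/idP => [[Qti /eqP <-]|Qi]; first exact: Qt.
    by rewrite Qt// tK.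
  move=> /andP[Qti /eqP ti]; have := Ft _ Qti; rewrite ti => ->.
  by rewrite opprK.
have : (\sum_(i | Q i) F i) *+ 2 = 0 by rewrite mulr2n {1}E addNr.
by move/eqP; rewrite mulrn_eq0 => /eqP.
Qed.
End Toggle.
Arguments toggle {T}.

(** * Enriched partitions on a single level *)

Section Local.
Variables (d : Order.disp_t) (P : finPOrderType d) (omega : P -> 'I_#|P|).
Hypothesis omega_inj : injective omega.
Implicit Types (D N : {set P}) (x y : P).

(* [N] is the set of elements with a negative value; [step] is the condition on
   two elements [x < y] of equal absolute value. *)
Definition step N x y : bool :=
  if x \in N then (y \notin N) || (omega y < omega x)%N
  else (y \notin N) && (omega x < omega y)%N.

(** Only the part of [N] inside [D] matters, so one global [N] can serve all levels at once. *)
Definition valid D N : bool :=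
  [forall x in D, forall y in D, (x < y)%O ==> step N x y].

Definition ambig D N x : bool := valid D (toggle N x).

(** Both signs at the ambiguous element give the same starred partition; [x \notin N] selects the
    positive one. Hence [eta] counts each starred partition once, and [#|N|] does not count the
    star. *)
Definition sole_ambig D N : bool :=
  [exists x in D, (x \notin N) && [forall y in D, ambig D N y == (y == x)]].

Definition eta D : rat :=
  \sum_(N : {set P} | [&& N \subset D, valid D N & sole_ambig D N]) (-1) ^+ #|N|.

Lemma validP D N :
  reflect (forall x y, x \in D -> y \in D -> (x < y)%O -> step N x y)
          (valid D N).
Proof.
apply: (iffP forall_inP) => h x.
  by move=> y xD yD; move/forall_inP: (h x xD) => /(_ y yD)/implyP.
by move=> xD; apply/forall_inP => y yD; apply/implyP; exact: h.
Qed.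

Lemma eq_step N N' x y :
  (x \in N) = (x \in N') -> (y \in N) = (y \in N') -> step N x y = step N' x y.
Proof. by rewrite /step => -> ->. Qed.

Lemma eq_valid D N N' : {in D, N =i N'} -> valid D N = valid D N'.
Proof.
move=> E; apply/validP/validP => h x y xD yD xy.
  by rewrite -(eq_step (E x xD) (E y yD)); exact: h.
by rewrite (eq_step (E x xD) (E y yD)); exact: h.
Qed.

Lemma eq_ambig D N N' x : {in D, N =i N'} -> ambig D N x = ambig D N' x.
Proof. by move=> E; apply: eq_valid => y yD; rewrite !in_toggle E. Qed.

Lemma eq_sole_ambig D N N' : {in D, N =i N'} -> sole_ambig D N = sole_ambig D N'.
Proof.
move=> E; apply: eq_existsb => x; case xD: (x \in D) => //=; rewrite E//.
by congr andb; apply: eq_forallb => y; rewrite (eq_ambig y E).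
Qed.

(** When [x] has the least label, [step] for a pair [x < y] reduces to [y \notin N], and for a pair
    [u < x] to [u \in N]. Neither involves the sign of [x]. *)
Lemma ambig_argmin D N x : x \in D -> valid D N ->
  (forall y, y \in D -> (omega x <= omega y)%N) -> ambig D N x.
Proof.
move=> xD /validP vN xmin; apply/validP => u v uD vD uv.
have lt y : y \in D -> y != x -> (omega x < omega y)%N.
  move=> yD yx; rewrite ltn_neqAle xmin// andbT.
  by apply: contra yx => /eqP/val_inj/omega_inj ->.
have := vN u v uD vD uv; rewrite /step !in_toggle.
have [ux|ux] := eqVneq u x; have [vx|vx] := eqVneq v x.
- by move: uv; rewrite ux vx ltxx.
- move: (lt v vD vx); rewrite ux => xv /=.
  by rewrite [(omega v < _)%N]ltnNge (ltnW xv) xv orbF andbT; case: (x \in N); case: (v \in N).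
- move: (lt u uD ux); rewrite vx => xu /=.
  rewrite [(omega u < _)%N]ltnNge (ltnW xu) xu.
  by case: (u \in N); case: (x \in N).
- by [].
Qed.

(** Since [step] never allows [x \notin N] with [y \in N], the hypotheses leave only [x \in N] and
    [y \notin N]; there the two flips require opposite orders of the labels. *)
Lemma ambig_incomparable N x y : (x < y)%O -> step N x y ->
  step (toggle N x) x y -> step (toggle N y) x y -> False.
Proof.
move=> xy; rewrite /step !in_toggle !eqxx (lt_eqF xy) (gt_eqF xy) !addTb !addFb.
case: (x \in N); case: (y \in N) => //=.
by move=> _ h1 h2; move: (ltn_trans h1 h2); rewrite ltnn.
Qed.

(** A pair avoiding [x] or [y] sees at most one flip. The remaining pair consists of [x] and [y]
    themselves, which [ambig_incomparable] excludes. *)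
Lemma ambig_toggle2 D N x y : valid D N -> x \in D -> y \in D ->
  ambig D N x -> ambig D N y -> x != y -> valid D (toggle (toggle N x) y).
Proof.
move=> vN xD yD ax ay xy; apply/validP => u v uD vD uv.
have [nu|] := boolP ((u != y) && (v != y)).
  rewrite (@eq_step _ (toggle N x)); first exact: (validP _ _ ax).
    by rewrite in_toggle (negbTE (proj1 (andP nu))).
  by rewrite in_toggle (negbTE (proj2 (andP nu))).
rewrite negb_and !negbK => hy.
have [nu|] := boolP ((u != x) && (v != x)).
  have [ux vx] := andP nu.
  rewrite (@eq_step _ (toggle N y)); first exact: (validP _ _ ay).
    by rewrite !in_toggle (negbTE ux).
  by rewrite !in_toggle (negbTE vx).
rewrite negb_and !negbK => hx; exfalso.
have H := validP _ _ vN u v uD vD uv.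
have Hx := validP _ _ ax u v uD vD uv.
have Hy := validP _ _ ay u v uD vD uv.
case/orP: hx => /eqP ex; case/orP: hy => /eqP ey; subst.
- by rewrite eqxx in xy.
- exact: ambig_incomparable uv H Hx Hy.
- exact: ambig_incomparable uv H Hy Hx.
- by rewrite eqxx in xy.
Qed.

(** From left to right, [ambig_toggle2] is applied to the toggled set. The invariance allows a flip
    chosen among the ambiguous elements to be undone. *)
Lemma ambig_toggle D N x y : valid D N -> x \in D -> y \in D ->
  ambig D N x -> ambig D (toggle N x) y = ambig D N y.
Proof.
move=> vN xD yD ax; have [<-|xy] := eqVneq x y.
  by rewrite ax /ambig toggleK.
apply/idP/idP => ay; last exact: ambig_toggle2.
have := @ambig_toggle2 D (toggle N x) x y ax xD yD.
by rewrite /ambig toggleK; apply.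
Qed.

Lemma exists_argmin D x : x \in D ->
  exists2 y, y \in D & forall z, z \in D -> (omega y <= omega z)%N.
Proof. by move=> xD; case: (arg_minnP (fun y => omega y : nat) xD) => y; exists y. Qed.

(** Flipping the element with the least label, which is always ambiguous, cancels all terms. *)
Lemma sum_valid0 D : D != set0 ->
  \sum_(N : {set P} | (N \subset D) && valid D N) (-1) ^+ #|N| = 0 :> rat.
Proof.
move=> /set0Pn[x0 x0D]; have [x xD xmin] := exists_argmin x0D.
apply: (@sum_involution0 _ _ (toggle^~ x)) => [N /andP[ND vN]|N _|N _].
- by rewrite toggle_sub// ND; exact: ambig_argmin.
- exact: toggleK.
- exact: sign_toggle.
Qed.

(** The factor [#|D :\: N|] marks an element outside [N]. Two cancellations leave only the sets in
    which the least-labelled element is marked and is the only ambiguous one. *)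
Lemma sum_valid_card D :
  \sum_(N : {set P} | (N \subset D) && valid D N) (-1) ^+ #|N| * #|D :\: N|%:R
  = eta D.
Proof.
have [->|/set0Pn[x0 x0D]] := eqVneq D set0.
  rewrite big1 => [|N _]; last by rewrite set0D cards0 mulr0.
  rewrite /eta big_pred0// => N; rewrite /sole_ambig.
  by apply/negbTE; rewrite !negb_and; apply/or3P/Or33/existsPn => x; rewrite inE.
have [x xD xmin] := exists_argmin x0D.
transitivity (\sum_(y in D) \sum_(N : {set P} |
    [&& N \subset D, valid D N & y \notin N]) (-1) ^+ #|N| : rat).
  rewrite (exchange_big_dep (fun N : {set P} => (N \subset D) && valid D N)) /=;
    last by move=> y N _ /and3P[-> ->].
  apply: eq_bigr => N /andP[ND vN]; rewrite -[#|D :\: N|]sum1_card natr_sum big_distrr /=.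
  by apply: eq_big => [y|y _]; rewrite ?mulr1// inE ND vN andbC.
(* A mark [y] other than the least-labelled [x] survives flipping [x], so these terms cancel. *)
rewrite (bigD1 x)//= [X in _ + X]big1 ?addr0 => [|y /andP[yD yx]]; last first.
  apply: (@sum_involution0 _ _ (toggle^~ x)) => [N /and3P[ND vN yN]|N _|N _].
  - rewrite toggle_sub// ND in_toggle (negbTE yx) yN andbT; exact: ambig_argmin.
  - exact: toggleK.
  - exact: sign_toggle.
pose other N := [pred y in D | ambig D N y && (y != x)].
(* With [x] marked, the sets having a further ambiguous element cancel too; the others give
   [eta]. *)
rewrite (bigID (fun N : {set P} => [exists y, other N y]))/=.
rewrite [X in X + _](_ : _ = 0) ?add0r.
  apply: eq_bigl => N; case ND: (N \subset D) => //=; case vN: (valid D N) => //=.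
  have ax : ambig D N x by exact: ambig_argmin.
  apply/andP/exists_inP => [[xN /existsPn no]|[z zD /andP[zN /forall_inP zu]]].
    exists x => //; rewrite xN; apply/forall_inP => y yD.
    have := no y; rewrite /= yD /=; have [-> _|yx] := eqVneq y x; first by rewrite ax.
    by rewrite andbT => /negbTE ->.
  have xz : x = z by apply/eqP; rewrite -(eqP (zu x xD)).
  subst z; split=> //; apply/existsPn => y; rewrite /=; case yD: (y \in D) => //=.
  by rewrite (eqP (zu y yD)); case: eqP.
(* By [ambig_toggle] the candidates are the same after the flip, so the same element is picked again
   and [t] is an involution. *)
pose t N := if [pick y | other N y] is Some y then toggle N y else N.
have tP N : valid D N -> [exists y, other N y] -> exists y,
    [/\ other N y, t N = toggle N y & t (t N) = toggle (t N) y].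
  move=> vN; rewrite /t; case E: [pick y | other N y] => [y|]; last first.
    by case: pickP E => // no _ /existsP[y]; rewrite no.
  have oy : other N y by case: pickP E => // z oz [<-].
  move=> _; exists y; split=> //; have /and3P[yD ay yx] := oy.
  rewrite (@eq_pick _ _ (other N)) => [|z]; last first.
    by rewrite /=; case zD: (z \in D) => //=; rewrite ambig_toggle.
  by rewrite E.
apply: (@sum_involution0 _ _ t) => N /andP[/and3P[ND vN xN] oN];
    have [y [oy tE ttE]] := tP N vN oN; have /and3P[yD ay yx] := oy.
- rewrite tE toggle_sub// ND (ay : valid _ _) in_toggle eq_sym (negbTE yx) xN /=.
  by apply/existsP; exists y; rewrite /= yD yx ambig_toggle// ay.
- by rewrite ttE tE toggleK.
- by rewrite tE sign_toggle.
Qed.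

End Local.

(** * Compositions and the Newton recursion *)

(* The first argument is fuel: [comps k n] is meaningful for [n <= k]. *)
Fixpoint comps (k n : nat) : seq (seq nat) :=
  if n is 0 then [:: [::]] else
  if k is k'.+1 then [seq rcons a j | j <- iota 1 n, a <- comps k' (n - j)]
  else [::].

Lemma mem_comps k n a : (n <= k)%N ->
  (a \in comps k n) = is_composition a && (sumn a == n).
Proof.
elim: k n a => [|k IH] [|n] a // nk.
1,2: by rewrite mem_seq1; case: a => [|[|x] a] //=; rewrite addSn andbF.
apply/idP/idP.
  move=> /allpairsPdep[j [c [+ + ->]]]; rewrite mem_iota => /andP[j0 jn].
  rewrite IH; last by rewrite leq_subLR (leq_trans nk)// -add1n leq_add2r.
  move=> /andP[c1 /eqP cn].
  rewrite /is_composition all_rcons -/(is_composition c) c1 j0 /= -cats1 sumn_cat cn /= addn0.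
  by rewrite subnK.
case/lastP: a => [|c j]; rewrite /is_composition ?all_rcons //.
rewrite -/(is_composition c) => /andP[/andP[j0 c1] /eqP cn].
have E : (sumn c + j = n.+1)%N by move: cn; rewrite -cats1 sumn_cat /= addn0.
apply/allpairsPdep; exists j, c; split=> //.
  by rewrite mem_iota j0 /= add1n ltnS -E leq_addl.
rewrite IH; last by rewrite leq_subLR (leq_trans nk)// -add1n leq_add2r.
by rewrite c1 -E addnK /=.
Qed.

Lemma comps_uniq k n : uniq (comps k n).
Proof.
elim: k n => [|k IH] [|n] //.
apply: allpairs_uniq_dep => [|j _|[j a] [j' a'] _ _ /=].
- exact: iota_uniq.
- exact: IH.
- by move/eqP; rewrite eqseq_rcons => /andP[/eqP -> /eqP ->].
Qed.

(** The last partial sum is the whole sum, the number by which the Newton recursion divides; hence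
    [comps] splits off the last part. *)
Lemma pi_comp_rcons a j : pi_comp (rcons a j) = (pi_comp a * (sumn a + j))%N.
Proof.
rewrite /pi_comp size_rcons big_nat_recr//=; congr muln.
  apply: eq_big_nat => i /andP[_ ia].
  by rewrite /partial_sum -cats1 takel_cat.
by rewrite /partial_sum take_oversize ?size_rcons// -cats1 sumn_cat /= addn0.
Qed.

(* The hypothesis is the noncommutative Newton identity between complete
   homogeneous functions [Z] and power sums [H]. *)
Lemma newton_expansion N (Z H : nat -> 'M[rat]_N) :
  Z 0%N = 1 ->
  (forall n, n%:R *: Z n = \sum_(j <- iota 1 n) Z (n - j)%N * H j) ->
  forall k n, (n <= k)%N ->
  Z n = \sum_(a <- comps k n) (pi_comp a)%:R^-1 *: \prod_(j <- a) H j.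
Proof.
have sAl c (M M' : 'M[rat]_N) : (c *: M) * M' = c *: (M * M').
  by rewrite -!mulmxE scalemxAl.
move=> Z0 ZH; elim=> [|k IH] [|n] // nk.
- by rewrite /= big_seq1 big_nil /pi_comp big_geq// invr1 scale1r.
- by rewrite /= big_seq1 big_nil /pi_comp big_geq// invr1 scale1r.
have n0 : n.+1%:R != 0 :> rat by rewrite pnatr_eq0.
have -> : Z n.+1 = n.+1%:R^-1 *: (n.+1%:R *: Z n.+1).
  by rewrite scalerA mulVf// scale1r.
rewrite ZH.
rewrite [comps _ _]/(allpairs_dep _ _ _) big_allpairs_dep -/(iota 1 n.+1).
rewrite scaler_sumr; apply: eq_big_seq => j; rewrite mem_iota => /andP[j0 jn].
have jk : (n.+1 - j <= k)%N by rewrite leq_subLR (leq_trans nk)// -add1n leq_add2r.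
rewrite IH// mulr_suml scaler_sumr; apply: eq_big_seq => a.
rewrite mem_comps// => /andP[_ /eqP sa].
rewrite sAl scalerA pi_comp_rcons sa subnK; last by rewrite -ltnS.
by rewrite natrM invfM mulrC big_rcons /=.
Qed.

(** A refinement of [b] is kept together with its cut into blocks, so that a product of expansions
    distributes over the list. *)
Fixpoint blockings (b : seq nat) : seq (seq (seq nat)) :=
  if b is n :: b' then [seq c :: bl | c <- comps n n, bl <- blockings b']
  else [:: [::]].

Lemma mem_blockings b bl :
  (bl \in blockings b) = all is_composition bl && ([seq sumn c | c <- bl] == b).
Proof.
elim: b bl => [|n b IH] [|c bl] //.
- by rewrite mem_seq1 andbF.
- by rewrite andbF; apply/negP => /allpairsPdep[c [bl []]].
rewrite /= eqseq_cons; apply/allpairsPdep/idP => [[c' [bl' []]]|].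
  by rewrite mem_comps// IH => /andP[cc /eqP sc] /andP[bb /eqP <-] [-> ->]; rewrite cc bb sc !eqxx.
move=> /andP[/andP[cc bb] /andP[sc sb]]; exists c, bl.
by rewrite mem_comps// cc sc IH bb sb.
Qed.

Lemma blockings_uniq b : uniq (blockings b).
Proof.
elim: b => [|n b IH] //; apply: allpairs_uniq_dep => [|c _|[c x] [c' x'] _ _ /= [-> ->]//].
  exact: comps_uniq.
exact: IH.
Qed.

(** For nonempty blocks of positive parts, this is [1 / pi(alpha, beta)] with [alpha] their
    concatenation and [beta] their sums. *)
Definition blocking_weight (bl : seq (seq nat)) : rat :=
  \prod_(c <- bl) (pi_comp c)%:R^-1.

Lemma newton_expansion_prod N (Z H : nat -> 'M[rat]_N) :
  Z 0%N = 1 ->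
  (forall n, n%:R *: Z n = \sum_(j <- iota 1 n) Z (n - j)%N * H j) ->
  forall b, \prod_(n <- b) Z n =
  \sum_(bl <- blockings b) blocking_weight bl *: \prod_(j <- flatten bl) H j.
Proof.
have sAl c (M M' : 'M[rat]_N) : (c *: M) * M' = c *: (M * M').
  by rewrite -!mulmxE scalemxAl.
have sAr c (M M' : 'M[rat]_N) : M * (c *: M') = c *: (M * M').
  by rewrite -!mulmxE scalemxAr.
move=> Z0 ZH; elim=> [|n b IH].
  by rewrite big_nil big_seq1 /= /blocking_weight !big_nil scale1r.
rewrite big_cons IH (newton_expansion Z0 ZH (leqnn n)).
rewrite [blockings (n :: b)]/(allpairs_dep _ _ _) big_allpairs_dep mulr_suml.
apply: eq_bigr => c _; rewrite mulr_sumr; apply: eq_bigr => bl _ /=.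
rewrite sAl sAr scalerA big_cat /=.
by rewrite /blocking_weight big_cons.
Qed.

(** * Kernels on a finite set as matrices *)

Section IncidenceMatrix.
Variable T : finType.
Implicit Types F G : T -> T -> rat.

(** Square matrices provide an associative product and make one-sided inverses two-sided. *)
Definition mat F : 'M[rat]_#|T| :=
  \matrix_(i, j) F (enum_val i) (enum_val j).

Lemma mat_mul F G : mat F * mat G = mat (fun x y => \sum_z F x z * G z y).
Proof.
apply/matrixP => i j; rewrite -mulmxE !mxE (reindex enum_rank) /=; last first.
  by apply: onW_bij; exists enum_val; [exact: enum_rankK|exact: enum_valK].
by apply: eq_bigr => z _; rewrite !mxE enum_rankK.
Qed.

Lemma mat1 : mat (fun x y => (x == y)%:R) = 1.
Proof. by apply/matrixP => i j; rewrite !mxE (inj_eq enum_val_inj). Qed.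

Lemma matE F x y : mat F (enum_rank x) (enum_rank y) = F x y.
Proof. by rewrite mxE !enum_rankK. Qed.

Lemma eq_mat F G : F =2 G -> mat F = mat G.
Proof. by move=> E; apply/matrixP => i j; rewrite !mxE E. Qed.

Lemma mat_inj F G : mat F = mat G -> F =2 G.
Proof. by move=> E x y; rewrite -!matE E. Qed.
End IncidenceMatrix.

(** * The incidence algebra and its Newton identity *)

Section Incidence.
Variables (d : Order.disp_t) (P : finPOrderType d) (omega : P -> 'I_#|P|).
Hypothesis omega_inj : injective omega.
Implicit Types (A B C D N : {set P}) (x y : P).
Local Notation valid := (valid omega).
Local Notation eta := (eta omega).

(** A down-set relative to [A], which may be any subset. In a chain ending at the whole poset,
    [lower_trans] makes every member an order ideal. *)
Definition lower B A : bool :=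
  (B \subset A) && [forall x in A, forall y in B, (x <= y)%O ==> (x \in B)].

Lemma lowerP B A :
  reflect (B \subset A /\ forall x y, x \in A -> y \in B -> (x <= y)%O -> x \in B)
          (lower B A).
Proof.
apply: (iffP andP) => -[BA h]; split=> //.
  by move=> x y xA yB; apply/implyP/(forall_inP (forall_inP h x xA)).
by apply/forall_inP => x xA; apply/forall_inP => y yB; apply/implyP; exact: h.
Qed.

Lemma lower_refl A : lower A A.
Proof. by apply/lowerP. Qed.

Lemma lower_trans C B A : lower B C -> lower C A -> lower B A.
Proof.
move=> /lowerP[BC hB] /lowerP[CA hC]; apply/lowerP; split.
  exact: subset_trans CA.
move=> x y xA yB xy; apply: (hB x y) => //.
exact: hC xA (subsetP BC _ yB) xy.
Qed.

Lemma card_lower C B A : lower B C -> lower C A ->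
  #|A :\: B| = (#|C :\: B| + #|A :\: C|)%N.
Proof.
move=> /lowerP[BC _] /lowerP[CA _].
rewrite (cardsD A B) (cardsD C B) (cardsD A C) (setIidPr BC) (setIidPr CA).
rewrite (setIidPr (subset_trans BC CA)) addnC addnBA ?subset_leq_card//.
by rewrite subnK ?subset_leq_card.
Qed.

(** For a valid [N], no element of [A :\: B] outside [N] lies below one of [N], so [B :|: N] is an
    intermediate down-set. Pairs from [N] up to its complement are unconstrained; what remains is
    that [omega] decreases on [N] and increases on the rest. *)
Lemma valid_split B N A : B \subset A -> N \subset A :\: B ->
  lower B A ->
  [&& lower B (B :|: N), lower (B :|: N) A, valid N N &
      valid (A :\: (B :|: N)) set0] = valid (A :\: B) N.
Proof.
move=> BA NAB lBA; have [_ hB] := lowerP _ _ lBA.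
have NA : N \subset A by apply: subset_trans NAB (subsetDl _ _).
have NB x : x \in N -> x \notin B by move/(subsetP NAB); rewrite inE => /andP[].
apply/and4P/validP => [[_ l2 /validP vN /validP v0] x y|h].
  rewrite !inE => /andP[xB xA] /andP[yB yA] xy; rewrite /step.
  have [xN|xN] := boolP (x \in N); have [yN|yN] //= := boolP (y \in N).
  - by have := vN x y xN yN xy; rewrite /step xN yN.
  - have [_ /(_ x y xA)] := lowerP _ _ l2.
    by rewrite !inE yN orbT (negbTE xB) (negbTE xN) => /(_ isT (ltW xy)).
  - have := v0 x y; rewrite !inE (negbTE xB) (negbTE xN) (negbTE yB) (negbTE yN).
    by rewrite /step !inE; exact.
split.
- apply/lowerP; split; first exact: subsetUl.
  move=> x y; rewrite inE => /orP[//|xN] yB xy; apply: (hB x y) => //.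
  exact: (subsetP NA).
- apply/lowerP; split; first by rewrite subUset BA.
  move=> x y xA; rewrite !inE => /orP[yB xy|yN xy]; first by rewrite (hB x y).
  have [//|xB] /= := boolP (x \in B).
  move: xy; rewrite le_eqVlt => /orP[/eqP -> //|xy].
  have := h x y; rewrite /step !inE xB xA (NB y yN) (subsetP NA y yN) yN.
  by move=> /(_ isT isT xy); case: (x \in N).
- apply/validP => x y xN yN xy.
  by apply: h; rewrite // inE NB// (subsetP NA).
- apply/validP => x y; rewrite !inE !negb_or.
  move=> /andP[/andP[xB xN] xA] /andP[/andP[yB yN] yA] xy.
  have := h x y; rewrite /step !inE xB yB xA yA (negbTE xN) (negbTE yN).
  exact.
Qed.

(** The substitution [C = B :|: N] and [valid_split] turn an entry of a matrix product into a signed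
    sum over valid sets. It serves for [F] constant 1 and for [F] the cardinality. *)
Lemma sum_between (F : {set P} -> rat) B A :
  \sum_C (if lower B C && valid (C :\: B) (C :\: B)
          then (-1) ^+ #|C :\: B| else 0) *
         (if lower C A && valid (A :\: C) set0 then F (A :\: C) else 0)
  = if lower B A then
      \sum_(N : {set P} | (N \subset A :\: B) && valid (A :\: B) N)
        (-1) ^+ #|N| * F ((A :\: B) :\: N)
    else 0.
Proof.
case: ifP => lBA; last first.
  apply: big1 => C _; case: ifP => [/andP[l1 _]|]; last by rewrite mul0r.
  case: ifP => [/andP[l2 _]|]; last by rewrite mulr0.
  by rewrite (lower_trans l1 l2) in lBA.
have [BA _] := lowerP _ _ lBA.
rewrite (bigID (fun C : {set P} => (B \subset C) && (C \subset A)))/=.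
rewrite [X in _ + X]big1 ?addr0 => [|C].
  rewrite [LHS](reindex_onto (fun N => B :|: N) (fun C => C :\: B)) /=; last first.
    move=> C /andP[BC CA]; apply/setP => x; rewrite !inE.
    by case xB: (x \in B) => //=; rewrite (subsetP BC).
  rewrite [LHS](_ : _ = \sum_(N : {set P} | N \subset A :\: B)
      if valid (A :\: B) N then (-1) ^+ #|N| * F ((A :\: B) :\: N) else 0).
    by rewrite -big_mkcondr.
  apply: eq_big => [N|N].
    rewrite subsetUl subUset BA /= subsetD; congr andb.
    apply/eqP/idP => [<-|/setDidPl dNB]; first by rewrite disjoints_subset subsetDr.
    by rewrite setDUl setDv set0U.
  move=> /andP[/andP[_ NA] /eqP E]; rewrite E.
  have NAB : N \subset A :\: B by rewrite -E setSD.
  rewrite -(valid_split BA NAB lBA) setDDl.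
  case: (lower B _); case: (valid N N); rewrite /= ?mul0r//.
    by case: ifP => //=; rewrite mulr0.
  by rewrite andbF.
move=> nC; case: ifP => [/andP[/lowerP[BC _] _]|]; last by rewrite mul0r.
case: ifP => [/andP[/lowerP[CA _] _]|]; last by rewrite mulr0.
by rewrite BC CA in nC.
Qed.

Definition zeta_mx (n : nat) : 'M[rat]_#|{set P}| :=
  mat (fun B A => ([&& lower B A, #|A :\: B| == n & valid (A :\: B) set0])%:R).

Definition eta_mx (n : nat) : 'M[rat]_#|{set P}| :=
  mat (fun B A => if lower B A && (#|A :\: B| == n) then eta (A :\: B) else 0).

Lemma valid_set0 N : valid set0 N.
Proof. by apply/validP => x; rewrite inE. Qed.

Lemma eta_set0 : eta set0 = 0.
Proof. by rewrite -sum_valid_card// big1// => N _; rewrite set0D cards0 mulr0. Qed.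

Lemma zeta_mx0 : zeta_mx 0 = 1.
Proof.
rewrite -mat1; apply: eq_mat => B A; congr ((nat_of_bool _)%:R).
rewrite cards_eq0 setD_eq0; have [->|BA] := eqVneq B A.
  by rewrite lower_refl subxx setDv valid_set0.
apply/negbTE/negP => /and3P[/lowerP[sBA _] sAB _].
by rewrite eqEsubset sBA sAB in BA.
Qed.

(* With X (B, A) = (-1)^|A \ B| when omega is decreasing on A \ B, one has
   X * zeta = 1 and X * (|A \ B| zeta) = eta, whence |A \ B| zeta = zeta * eta. *)
Lemma zeta_eta B A :
  \sum_C (lower B C && valid (C :\: B) set0)%:R *
         (if lower C A then eta (A :\: C) else 0)
  = if lower B A && valid (A :\: B) set0 then #|A :\: B|%:R else 0.
Proof.
pose Z B A : rat := if lower B A && valid (A :\: B) set0 then 1 else 0.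
pose X B A : rat := if lower B A && valid (A :\: B) (A :\: B)
  then (-1) ^+ #|A :\: B| else 0.
pose Y B A : rat := if lower B A && valid (A :\: B) set0
  then #|A :\: B|%:R else 0.
pose H B A : rat := if lower B A then eta (A :\: B) else 0.
have XZ : mat X * mat Z = 1.
  rewrite mat_mul -mat1; apply: eq_mat => {}B {}A.
  rewrite [LHS](sum_between (fun=> 1)); have [->|BA] := eqVneq B A.
    rewrite lower_refl setDv (big_pred1 set0) ?cards0 ?mulr1// => N /=.
    by rewrite subset0 valid_set0 andbT.
  case: ifP => // /lowerP[sBA _]; under eq_bigr do rewrite mulr1.
  apply: sum_valid0 => //; apply: contra BA; rewrite setD_eq0 eqEsubset.
  by move=> ->; rewrite sBA.
have XY : mat X * mat Y = mat H.
  rewrite mat_mul; apply: eq_mat => {}B {}A.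
  rewrite [LHS](sum_between (fun D => #|D|%:R)) /H.
  by case: ifP => // _; rewrite sum_valid_card.
(* A left inverse of a square matrix is also a right inverse. *)
have ZX : mat Z * mat X = 1.
  by rewrite -mulmxE; apply: mulmx1C; rewrite mulmxE.
have /mat_inj/(_ B A) : mat (fun B A => \sum_C Z B C * H C A) = mat Y.
  by rewrite -mat_mul -XY mulrA ZX mul1r.
rewrite -/(Y B A) => <-; apply: eq_bigr => C _; congr (_ * _).
by rewrite /Z; case: ifP.
Qed.

(** The graded form of [zeta_eta]: by [card_lower] the sizes of [C :\: B] and [A :\: C] add up, so
    [C] contributes only at [j = #|A :\: C|]. *)
Lemma zeta_mx_newton n :
  n%:R *: zeta_mx n = \sum_(j <- iota 1 n) zeta_mx (n - j) * eta_mx j.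
Proof.
apply/matrixP => i i'; rewrite mxE summxE.
rewrite -[i]enum_valK -[i']enum_valK matE.
move: (enum_val i) (enum_val i') => B A {i i'}.
under eq_bigr do rewrite mat_mul matE.
rewrite exchange_big /=.
transitivity (\sum_C (if #|A :\: B| == n then
    (lower B C && valid (C :\: B) set0)%:R *
    (if lower C A then eta (A :\: C) else 0) else 0)); last first.
  apply: eq_bigr => C _.
  have [l1|nl1] := boolP (lower B C); last by rewrite big1 ?mul0r ?if_same// => j _; rewrite mul0r.
  have [l2|nl2] := boolP (lower C A); last by rewrite big1 ?mulr0 ?if_same// => j _; rewrite mulr0.
  rewrite (card_lower l1 l2) /=.
  (* The index [j] starts at 1, so nothing on the left matches an empty [A :\: C]; the corresponding
     term on the right is zero by [eta_set0]. *)
  have [A0|An0] := posnP #|A :\: C|.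
    rewrite big_seq_cond big1 => [|j]; last first.
      by rewrite mem_iota A0 => /andP[/andP[j0 _] _]; rewrite (ltn_eqF j0) mulr0.
    by move/eqP: A0; rewrite cards_eq0 => /eqP ->; rewrite eta_set0 mulr0 if_same.
  case: eqP => [En|nE].
    rewrite (bigD1_seq #|A :\: C|) ?iota_uniq//=; last first.
      by rewrite mem_iota An0 add1n ltnS -En leq_addl.
    rewrite -{1}En addnK !eqxx /= big1 ?addr0// => j jC.
    by rewrite [_ == j]eq_sym (negbTE jC) mulr0.
  rewrite big_seq_cond big1// => j; rewrite mem_iota => /andP[/andP[j0 jn] _].
  case: (eqVneq _ j) => [Ej|]; last by rewrite mulr0.
  case: eqP => [Ec|]; last by rewrite mul0r.
  by case: nE; rewrite Ec Ej subnK.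
have [En|nE] := eqVneq #|A :\: B| n; last by rewrite big1// andbF mulr0.
by rewrite zeta_eta En /=; case: ifP => _; rewrite ?mulr1 ?mulr0.
Qed.

End Incidence.

(** * Matrix products as sums over chains of sets *)

Section Flags.
Variables (d : Order.disp_t) (P : finPOrderType d).
Implicit Types (A B C D N : {set P}) (x y : P).

(** A chain starting at the empty set is encoded by the step [h x] at which each element enters;
    [below] recovers its members and [level] their successive differences. *)
Definition below (K : nat) (h : {ffun P -> 'I_K}) (j : nat) : {set P} :=
  [set x | (h x < j)%N].

Definition level (K : nat) (h : {ffun P -> 'I_K}) (j : nat) : {set P} :=
  [set x | h x == j :> nat].

Lemma level_below K (h : {ffun P -> 'I_K}) j :
  below h j.+1 :\: below h j = level h j.
Proof. by apply/setP => x; rewrite !inE ltnS -leqNgt -eqn_leq eq_sym. Qed.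

Lemma mul_matE (M : 'M[rat]_#|{set P}|) (F : {set P} -> {set P} -> rat) i A :
  (M * mat F) i (enum_rank A) = \sum_C M i (enum_rank C) * F C A.
Proof.
rewrite -mulmxE mxE (reindex enum_rank) /=; last first.
  by apply: onW_bij; exists enum_val; [exact: enum_rankK|exact: enum_valK].
by apply: eq_bigr => C _; rewrite matE.
Qed.

(** The sum runs over chains from the empty set to [A], and the value [k] marks the elements outside
    [A]. The bound [K] is fixed to keep the type of [h] constant during the induction on [k]. *)
Lemma prod_mat_flags (w : nat -> {set P} -> {set P} -> rat) K k A :
  (forall j C D, ~~ (C \subset D) -> w j C D = 0) -> (k <= K)%N ->
  (\prod_(0 <= j < k) mat (w j)) (enum_rank set0) (enum_rank A) =
  \sum_(h : {ffun P -> 'I_K.+1} | [forall x, (h x <= k)%N] && (below h k == A))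
    \prod_(0 <= j < k) w j (below h j) (below h j.+1).
Proof.
move=> w0; elim: k A => [|k IH] A kK.
  rewrite big_geq// -mat1 matE.
  under [RHS]eq_bigr do rewrite big_geq//.
  have b0 (h : {ffun P -> 'I_K.+1}) : below h 0 = set0.
    by apply/setP => x; rewrite !inE.
  under eq_bigl do rewrite b0.
  have [_|_] := eqVneq set0 A; last by rewrite big1// => h; rewrite andbF.
  rewrite (big_pred1 [ffun=> ord0])// => h /=; rewrite andbT.
  apply/forallP/eqP => [h0|-> x]; last by rewrite ffunE.
  by apply/ffunP => x; rewrite ffunE; apply/val_inj/eqP; rewrite -leqn0 h0.
rewrite big_nat_recr// mul_matE.
transitivity (\sum_(h : {ffun P -> 'I_K.+1} | [forall x, (h x <= k)%N])
    (\prod_(0 <= j < k) w j (below h j) (below h j.+1)) * w k (below h k) A).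
  rewrite [RHS](partition_big (fun h => below h k) predT)//=.
  apply: eq_bigr => C _; apply: (etrans (congr1 ( *%R^~ _) (IH C (ltnW kK)))).
  by rewrite mulr_suml; apply: eq_bigr => h /andP[_ /eqP ->].
(* To append [A] to a chain, the elements outside [A] move from [k] to the new marker [k.+1]; the
   elements of [A] still at [k] become the new level. *)
pose up (h : {ffun P -> 'I_K.+1}) : {ffun P -> 'I_K.+1} :=
  [ffun x => if x \in A then h x else inord k.+1].
pose down (h : {ffun P -> 'I_K.+1}) : {ffun P -> 'I_K.+1} :=
  [ffun x => if (h x <= k)%N then h x else inord k].
have ik1 : @inord K k.+1 = k.+1 :> nat by rewrite inordK.
have ik : @inord K k = k :> nat by rewrite inordK// ltnW.
rewrite [RHS](reindex_onto up down) /=; last first.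
  move=> h /andP[/forallP hk /eqP hA]; apply/ffunP => x; rewrite !ffunE.
  have xA : (x \in A) = (h x <= k)%N by rewrite -hA inE ltnS.
  rewrite xA; case: ifP => [->//|xk]; apply/ord_inj; rewrite ik1.
  by apply/eqP; rewrite eqn_leq hk andbT ltnNge xk.
rewrite (bigID (fun h : {ffun P -> 'I_K.+1} => below h k \subset A)) /=.
rewrite [X in _ + X]big1 ?addr0 => [|h /andP[_ hA]]; last by rewrite w0 ?mulr0.
apply: eq_big => [h|h /andP[/forallP hk /subsetP hA]].
  apply/andP/andP => [[/forallP hk /subsetP hA]|[/andP[_ /eqP uA] /eqP du]].
    have hA' x : x \notin A -> h x = k :> nat.
      move=> xA; apply/eqP; rewrite eqn_leq hk leqNgt; apply: contra xA => xk.
      by apply: hA; rewrite inE.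
    split.
      apply/andP; split.
        by apply/forallP => x; rewrite ffunE; case: ifP; rewrite ?ik1// leqW.
      apply/eqP/setP => x; rewrite inE ffunE ltnS; case: ifP; rewrite ?hk//.
      by rewrite ik1 ltnn.
    apply/eqP/ffunP => x; rewrite !ffunE.
    have [xA|xA] := boolP (x \in A); first by rewrite hk.
    by rewrite ik1 ltnn; apply/ord_inj; rewrite ik hA'.
  have duE x : down (up h) x = h x by rewrite du.
  split.
    apply/forallP => x; rewrite -duE ffunE; case: ifP => //.
    by rewrite ik.
  apply/subsetP => x; rewrite inE -duE !ffunE.
  by case: (x \in A) => //; rewrite ik1 ltnn ik ltnn.
have hA' x : x \notin A -> h x = k :> nat.
  move=> xA; apply/eqP; rewrite eqn_leq hk leqNgt; apply: contra xA => xk.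
  by apply: hA; rewrite inE.
have bE j : (j <= k)%N -> below (up h) j = below h j.
  move=> jk; apply/setP => x; rewrite !inE ffunE; case: ifP => // /negbT xA.
  by rewrite ik1 (hA' _ xA) !ltnNge jk leqW.
rewrite big_nat_recr//= bE//; congr (_ * _).
  by apply: eq_big_nat => j /andP[_ jk]; rewrite !bE// ltnW.
congr w; apply/setP => x; rewrite inE ffunE ltnS; case: ifP; rewrite ?hk//.
by rewrite ik1 ltnn.
Qed.

Definition monotone (K : nat) (h : {ffun P -> 'I_K}) : bool :=
  [forall x, forall y, (x <= y)%O ==> (h x <= h y)%N].

Lemma monotoneP K (h : {ffun P -> 'I_K}) :
  reflect (forall x y, (x <= y)%O -> (h x <= h y)%N) (monotone h).
Proof.
apply: (iffP forallP) => H x; last by apply/forallP => y; apply/implyP; exact: H.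
by move=> y; exact: (implyP (forallP (H x) y)).
Qed.

Lemma monotone_lower K (h : {ffun P -> 'I_K}) k : (forall x, (h x < k)%N) ->
  monotone h = [forall j : 'I_k, lower (below h j) (below h j.+1)].
Proof.
move=> hk; apply/monotoneP/forallP => [hm j|hl x y xy].
  apply/lowerP; split; first by apply/subsetP => x; rewrite !inE => /leqW.
  by move=> x y; rewrite !inE => _ yj xy; apply: leq_ltn_trans yj; exact: hm.
rewrite leqNgt; apply/negP => yx.
have [_ /(_ x y)] := lowerP _ _ (hl (Ordinal (hk x))).
by rewrite !inE ltnn /= ltnSn => /(_ isT yx xy).
Qed.

(* The extra value [size b], excluded here, marks the elements that are not yet
   placed in the partial flags of [prod_mat_flags]. *)
Definition flag (b : seq nat) (h : {ffun P -> 'I_(size b).+1}) : bool :=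
  [&& [forall x, (h x < size b)%N], monotone h &
      [forall j : 'I_(size b), #|level h j| == nth 0%N b j]].

(** A chain can contribute only if its steps satisfy [lower], which makes [h] monotone, and have the
    sizes listed in [b]; any other chain has a zero factor. *)
Lemma prod_mat_level (F : {set P} -> rat) (b : seq nat) :
  (\prod_(n <- b) mat (fun B A =>
      if lower B A && (#|A :\: B| == n) then F (A :\: B) else 0))
    (enum_rank set0) (enum_rank setT) =
  \sum_(h | @flag b h) \prod_(j < size b) F (level h j).
Proof.
rewrite (big_nth 0%N) (@prod_mat_flags _ (size b))//; last first.
  by move=> j C D /negP CD; case: ifP => // /andP[/lowerP[]].
rewrite (bigID (@flag b)) /= [X in _ + X]big1 ?addr0.
  apply: eq_big => [h|h].
    apply/andP/idP => [[]//|fh]; split=> //; have /and3P[/forallP hk _ _] := fh.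
    apply/andP; split; first by apply/forallP => x; rewrite ltnW.
    by apply/eqP/setP => x; rewrite !inE hk.
  move=> /andP[_ /and3P[/forallP hk hm /forallP hs]]; rewrite big_mkord.
  apply: eq_bigr => j _; rewrite level_below hs andbT.
  by move: hm; rewrite (monotone_lower hk) => /forallP ->.
move=> h /andP[/andP[_ /eqP hb] nf]; apply/eqP; rewrite big_mkord prodf_seq_eq0.
have hk x : (h x < size b)%N by have := in_setT x; rewrite -hb inE.
move: nf; rewrite /flag (introT forallP hk) /= (monotone_lower hk) negb_and.
have E (j : 'I_(size b)) : ~~ (lower (below h j) (below h j.+1) && (#|level h j| == nth 0%N b j)) ->
  has (fun i : 'I_(size b) => (if lower (below h i) (below h i.+1) &&
   (#|below h i.+1 :\: below h i| == nth 0%N b i) then F (below h i.+1 :\: below h i) else 0) == 0) (index_enum _).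
  move=> nj; apply/hasP; exists j; first exact: mem_index_enum.
  by rewrite level_below (negbTE nj).
by case/orP => /forallPn[j nj]; apply: (E j); rewrite negb_and nj ?orbT.
Qed.

End Flags.

(** * Expansions of the two products over flags *)

Section EtaFlags.
Variables (d : Order.disp_t) (P : finPOrderType d) (omega : P -> 'I_#|P|).
Implicit Types (A B C D N : {set P}) (x y : P) (b : seq nat).
Local Notation valid := (valid omega).
Local Notation sole_ambig := (sole_ambig omega).
Local Notation eta := (eta omega).

Lemma prod_zeta_flags b :
  (\prod_(n <- b) zeta_mx omega n) (enum_rank set0) (enum_rank setT) =
  \sum_(h | @flag d P b h) [forall j : 'I_(size b), valid (level h j) set0]%:R.
Proof.
transitivity (\sum_(h | @flag d P b h)
    \prod_(j < size b) (valid (level h j) set0)%:R : rat).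
  rewrite -(prod_mat_level (fun D => (valid D set0)%:R)); congr (fun_of_matrix _ _ _).
  apply: eq_bigr => n _; apply: eq_mat => B A.
  by case: lower => //=; case: eqP.
apply: eq_bigr => h _; case: forallP => [H|/forallP].
  by rewrite big1// => j _; rewrite H.
by move=> /forallPn[j nj]; rewrite (bigD1 j)//= (negbTE nj) mul0r.
Qed.

(* Encodes a pointed partition: [h] gives the absolute values (shifted by one),
   and each starred element is made positive. *)
Definition signed_flag b (h : {ffun P -> 'I_(size b).+1}) N : bool :=
  flag h && [forall j : 'I_(size b),
               valid (level h j) N && sole_ambig (level h j) N].

(** Expanding the product chooses a subset of each level. The levels partition [P], so such a family
    amounts to its union [N], and cardinalities add up in the exponent. *)
Lemma prod_eta_levels b (h : {ffun P -> 'I_(size b).+1}) :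
  (forall x, (h x < size b)%N) ->
  \prod_(j < size b) eta (level h j) =
  \sum_(N : {set P} | [forall j : 'I_(size b),
      valid (level h j) N && sole_ambig (level h j) N]) (-1) ^+ #|N|.
Proof.
move=> hk; rewrite /eta bigA_distr_big_dep /=.
rewrite [LHS](reindex_onto (fun N : {set P} => [ffun j : 'I_(size b) => N :&: level h j])
   (fun f => \bigcup_j f j)) /=; last first.
  move=> f /familyP ff; apply/ffunP => j; rewrite ffunE; apply/setP => x.
  have fs i : f i \subset level h i by have /and3P[] := ff i.
  rewrite inE; apply/andP/idP => [[/bigcupP[i _ xi] xj]|xj]; last first.
    by split; [apply/bigcupP; exists j|exact: (subsetP (fs j))].
  have := subsetP (fs i) _ xi; move: xj; rewrite !inE => /eqP -> /eqP ji.
  by have -> : j = i by exact: val_inj.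
have capE N j : {in level h j, N :&: level h j =i N}.
  by move=> x xj; rewrite inE xj andbT.
have UE N : \bigcup_(j < size b) (N :&: level h j) = N.
  apply/setP => x; apply/bigcupP/idP => [[j _]|xN]; first by rewrite inE => /andP[].
  by exists (Ordinal (hk x)) => //; rewrite !inE xN /=.
apply: eq_big => [N|N _].
  rewrite (_ : (_ == N) = true) ?andbT; last first.
    by apply/eqP; rewrite -[RHS]UE; apply: eq_bigr => j _; rewrite ffunE.
  apply/familyP/forallP => H j; have := H j; rewrite ?ffunE.
    by move=> /and3P[_]; rewrite (eq_valid _ (capE N j)) (eq_sole_ambig _ (capE N j)) => -> ->.
  rewrite /in_mem /= subsetIr (eq_valid _ (capE N j)) (eq_sole_ambig _ (capE N j)).
  by [].
under eq_bigr do rewrite ffunE.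
rewrite -expr_sum; congr (_ ^+ _).
rewrite -[in RHS]sum1_card (partition_big (fun x => Ordinal (hk x)) predT)//=.
apply: eq_bigr => j _; rewrite -sum1_card; apply: eq_bigl => x.
by rewrite !inE -val_eqE.
Qed.

Lemma prod_eta_flags b :
  (\prod_(n <- b) eta_mx omega n) (enum_rank set0) (enum_rank setT) =
  \sum_(p : {ffun P -> 'I_(size b).+1} * {set P} | signed_flag p.1 p.2)
    (-1) ^+ #|p.2|.
Proof.
rewrite prod_mat_level [RHS](eq_bigl (fun p => flag p.1 &&
   [forall j : 'I_(size b), valid (level p.1 j) p.2 && sole_ambig (level p.1 j) p.2]))//.
rewrite -(pair_big_dep (fun h => flag h) (fun h N => [forall j : 'I_(size b), valid (level h j) N && sole_ambig (level h j) N]) (fun _ N => (-1) ^+ #|N|)) /=.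
by apply: eq_bigr => h /and3P[/forallP hk _ _]; exact: prod_eta_levels.
Qed.

End EtaFlags.

(** * Pointed partitions as signed flags *)

Section EnrichedFlags.
Variables (d : Order.disp_t) (P : finPOrderType d) (omega : P -> 'I_#|P|).
Hypothesis omega_inj : injective omega.
Implicit Types (A B C D N : {set P}) (x y : P) (b : seq nat) (f : {ffun P -> int}).
Local Notation step := (step omega).
Local Notation valid := (valid omega).
Local Notation ambig := (ambig omega).
Local Notation sole_ambig := (sole_ambig omega).
Local Notation signed_flag := (signed_flag omega).

(** Induction on the number of elements strictly between [x] and [y]; any such element splits the
    interval into two smaller ones. *)
Lemma lt_cover_ind (R : P -> P -> Prop) :
  (forall x y z, R x y -> R y z -> R x z) ->
  (forall x y, covered_by x y -> R x y) -> forall x y, (x < y)%O -> R x y.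
Proof.
move=> Rtr Rcov x y; have [n] := ubnP #|[set z | (x < z < y)%O]|.
elim: n x y => // n IH x y; rewrite ltnS => le xy.
have [/existsP[z /andP[xz zy]]|/existsPn no] := boolP [exists z, (x < z < y)%O].
  have zI : z \in [set z | (x < z < y)%O] by rewrite inE xz.
  apply: (Rtr _ z); apply: IH => //; apply: leq_trans le;
    rewrite (cardsD1 z [set z0 | (x < z0 < y)%O]) zI add1n ltnS;
    apply: subset_leq_card; apply/subsetP => u; rewrite !inE => /andP[u1 u2].
  - by rewrite (lt_eqF u2) u1 (lt_trans u2 zy).
  - by rewrite (gt_eqF u1) u2 (lt_trans xz u1).
apply: Rcov; split=> // z [xz zy]; have := no z; by rewrite xz zy.
Qed.

Definition neg_set f : {set P} := [set x | f x < 0].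

(* Unlike the conditions on covers in [enriched_partition], this relation is
   transitive, so it can be required on all pairs x < y. *)
Definition enriched_le f x y : Prop :=
  (`|f x| < `|f y|)%N \/ (`|f x| = `|f y|)%N /\ step (neg_set f) x y.

Lemma enriched_le_trans f x y z :
  enriched_le f x y -> enriched_le f y z -> enriched_le f x z.
Proof.
move=> [xy|[xy sxy]] [yz|[yz syz]]; first by left; exact: ltn_trans yz.
- by left; rewrite -yz.
- by left; rewrite xy.
right; rewrite xy; split=> //; move: sxy syz; rewrite /step.
case: (x \in _); case: (y \in _); case: (z \in _) => //=.
  by move=> h1 h2; exact: ltn_trans h1.
exact: ltn_trans.
Qed.

(** Transitivity of [enriched_le] spreads the conditions from covers to all pairs, a form that can
    be tested level by level. *)
Lemma enriched_partitionE f : enriched_partition omega f <->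
  [/\ forall x, f x != 0,
      exists k : nat, forall i : nat, (1 <= i <= k)%N <-> exists x, `|f x|%N = i &
      forall x y, (x < y)%O -> enriched_le f x y].
Proof.
split=> -[f0 fk fle]; split=> //.
  apply: lt_cover_ind => [x y z|x y cxy]; first exact: enriched_le_trans.
  have [le1 le2 le3] := fle x y cxy; move: le1; rewrite /leP'.
  have [E|nE] /= := eqVneq `|f x|%N `|f y|%N; last by rewrite orbF; left.
  rewrite E ltnn /= => lexy; right; split=> //.
  have nxy : (omega x != omega y :> nat).
    apply/negP => /eqP/val_inj/omega_inj xy; case: cxy; by rewrite xy ltxx.
  rewrite /step !inE -!leNgt.
  have {}le2 := le2 E; have {}le3 := le3 E.
  case: (ltP (f x) 0) => fx; last first.
    rewrite (le_trans fx lexy) /=; move: nxy; rewrite neq_ltn => /orP[//|/le3].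
    by rewrite ltNge fx.
  case: (leP 0 (f y)) => //= fy; move: nxy; rewrite neq_ltn => /orP[/le2|//].
  by rewrite ltNge (ltW fy).
move=> x y [xy _]; have := fle x y xy; rewrite /enriched_le /step !inE -!leNgt.
move=> [lxy|[E sxy]].
  by split; [rewrite /leP' lxy|move=> E; rewrite E ltnn in lxy|move=> E; rewrite E ltnn in lxy].
move: sxy; case: (ltP (f x) 0) => fx.
  have fxE : f x = - `|f x|%N%:Z by rewrite ltz0_abs// opprK.
  case: (leP 0 (f y)) => /= fy.
    move=> _; split=> // [|_ _]; last by rewrite lt_neqAle eq_sym f0.
    by rewrite /leP' E eqxx (le_trans (ltW fx) fy) orbT.
  have fyE : f y = - `|f y|%N%:Z by rewrite ltz0_abs// opprK.
  move=> yx; split=> //; first by rewrite /leP' E eqxx fxE fyE E lexx orbT.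
  by move=> _ xy'; rewrite ltnNge (ltnW yx) in xy'.
move=> /andP[fy lxy]; split.
- by rewrite /leP' E eqxx -(gez0_abs fx) -(gez0_abs fy) E lexx orbT.
- by rewrite lt_neqAle eq_sym f0.
- by move=> _ yx; rewrite ltnNge (ltnW yx) in lxy.
Qed.

(** Flags count levels from 0 and enriched partitions count absolute values from 1, whence the
    successor. *)
Definition mkf K (h : {ffun P -> 'I_K}) N : {ffun P -> int} :=
  [ffun x => if x \in N then - (h x).+1%:Z else (h x).+1%:Z].

Lemma abs_mkf K (h : {ffun P -> 'I_K}) N x : `|mkf h N x|%N = (h x).+1.
Proof. by rewrite ffunE; case: ifP; rewrite ?abszN. Qed.

Lemma mkf_lt0 K (h : {ffun P -> 'I_K}) N x : (mkf h N x < 0) = (x \in N).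
Proof. by rewrite ffunE; case: ifP => //; rewrite oppr_lt0. Qed.

Lemma mkf_neq0 K (h : {ffun P -> 'I_K}) N x : mkf h N x != 0.
Proof. by rewrite -absz_gt0 abs_mkf. Qed.

Lemma neg_set_mkf K (h : {ffun P -> 'I_K}) N : neg_set (mkf h N) = N.
Proof. by apply/setP => x; rewrite inE mkf_lt0. Qed.

Lemma flip_mkf K (h : {ffun P -> 'I_K}) N x :
  flip_at (mkf h N) x = mkf h (toggle N x).
Proof.
apply/ffunP => y; rewrite !ffunE in_toggle; case: eqVneq => //= _.
by case: (y \in N); rewrite ?opprK.
Qed.

Section FixedComposition.
Variables (b : seq nat) (h : {ffun P -> 'I_(size b).+1}).
Hypotheses (b_comp : is_composition b) (h_lt : forall x, (h x < size b)%N).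
Hypothesis h_size : forall j : 'I_(size b), #|level h j| = nth 0%N b j.

Lemma level_surj j : (j < size b)%N -> exists x, h x = j :> nat.
Proof.
move=> jb; have : (0 < #|level h j|)%N.
  by rewrite (h_size (Ordinal jb)); move/allP: b_comp; apply; exact: mem_nth.
by move=> /card_gt0P[x]; rewrite inE => /eqP; exists x.
Qed.

Lemma enriched_mkf N : enriched_partition omega (mkf h N) <->
  monotone h && [forall j : 'I_(size b), valid (level h j) N].
Proof.
rewrite enriched_partitionE; split.
  move=> [_ _ le]; apply/andP; split.
    apply/monotoneP => x y; rewrite le_eqVlt => /orP[/eqP -> //|/le].
    by rewrite /enriched_le !abs_mkf => -[/ltnW//|[[->] _]].
  apply/forallP => j; apply/validP => x y; rewrite !inE => /eqP xj /eqP yj /le.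
  by rewrite /enriched_le !abs_mkf neg_set_mkf xj yj ltnn => -[|[]].
move=> /andP[/monotoneP hm /forallP hv]; split; first exact: mkf_neq0.
  exists (size b) => -[|i]; split=> //=.
  - by move=> [x]; rewrite abs_mkf.
  - by move=> /level_surj[x xi]; exists x; rewrite abs_mkf xi.
  - by move=> [x]; rewrite abs_mkf => -[<-].
move=> x y xy; rewrite /enriched_le !abs_mkf neg_set_mkf ltnS.
have := hm x y (ltW xy); rewrite leq_eqVlt => /orP[/eqP E|]; last by left.
right; split; first by rewrite E.
by apply: (validP _ _ _ (hv (Ordinal (h_lt x)))); rewrite // !inE /= E.
Qed.

(** Flipping [x] keeps the absolute values, so it can break validity only on the level of [x]. *)
Lemma ambiguous_mkf N x : monotone h ->
    (forall j : 'I_(size b), valid (level h j) N) ->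
  ambiguous omega (mkf h N) x <-> ambig (level h (h x)) N x.
Proof.
move=> hm hv; rewrite /ambiguous flip_mkf enriched_mkf hm /=; split.
  by move/forallP/(_ (Ordinal (h_lt x))).
move=> ax; apply/forallP => j; have [jx|jx] := eqVneq (h x : nat) j.
  by rewrite -jx.
rewrite (@eq_valid _ _ _ _ _ N)// => y; rewrite inE in_toggle => /eqP yj.
by case: eqVneq => // yx; rewrite -yj yx eqxx in jx.
Qed.

Lemma starred_mkf N x : monotone h ->
    (forall j : 'I_(size b), valid (level h j) N) ->
  starred_of omega (mkf h N) x =
  if ambig (level h (h x)) N x then inr (h x).+1 else inl (mkf h N x).
Proof.
move=> hm hv; rewrite ffunE abs_mkf; case: ifPn => [/asboolP/ambiguous_mkf ->//|].
by move/asboolPn; case: ifP => // ax; case; apply/ambiguous_mkf.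
Qed.

Lemma abs_starred_mkf N x : abs_starred (starred_of omega (mkf h N) x) = (h x).+1.
Proof. by rewrite ffunE; case: ifP => _ /=; rewrite abs_mkf. Qed.

Lemma max_abs_mkf N : max_abs (starred_of omega (mkf h N)) = size b.
Proof.
rewrite /max_abs; apply/eqP; rewrite eqn_leq; apply/andP; split.
  by apply/bigmax_leqP => x _; rewrite abs_starred_mkf.
have [b0|b0] := posnP (size b); first by rewrite [leqLHS]b0.
have [x xk] : exists x, h x = (size b).-1 :> nat.
  by apply: level_surj; rewrite prednK.
by rewrite (bigD1 x)//= abs_starred_mkf xk prednK// leq_maxl.
Qed.

Lemma wt_mkf N : wt (starred_of omega (mkf h N)) = b.
Proof.
rewrite /wt max_abs_mkf; apply: (@eq_from_nth _ 0%N).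
  by rewrite size_map size_iota.
rewrite size_map size_iota => j jb; rewrite (nth_map 0%N) ?size_iota//.
rewrite nth_iota// add1n -(h_size (Ordinal jb)); apply: eq_card => x.
by rewrite !inE abs_starred_mkf eqSS.
Qed.

End FixedComposition.

Lemma signed_flagP b (h : {ffun P -> 'I_(size b).+1}) N : signed_flag h N ->
  [/\ forall x, (h x < size b)%N, forall j : 'I_(size b), #|level h j| = nth 0%N b j,
      monotone h, forall j : 'I_(size b), valid (level h j) N &
      forall j : 'I_(size b), sole_ambig (level h j) N].
Proof.
move=> /andP[/and3P[/forallP h1 h2 /forallP h3] /forallP h4]; split=> //.
- by move=> j; apply/eqP.
- by move=> j; have /andP[] := h4 j.
- by move=> j; have /andP[] := h4 j.
Qed.

(** The only ambiguous element of each level lies outside [N], so starring it removes no negative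
    value. *)
Lemma neg_starred_mkf b (h : {ffun P -> 'I_(size b).+1}) N x :
  is_composition b -> signed_flag h N ->
  neg_starred (starred_of omega (mkf h N) x) = (x \in N).
Proof.
move=> bc /signed_flagP[h1 h2 h3 h4 h5]; rewrite (starred_mkf bc)//.
case: ifP => /= ax; last by rewrite mkf_lt0.
have /exists_inP[z _ /andP[zN /forall_inP zu]] := h5 (Ordinal (h1 x)).
have := zu x; rewrite inE eqxx ax => /(_ isT)/eqP/esym/eqP ->.
by rewrite (negbTE zN).
Qed.

Lemma sign_mkf b (h : {ffun P -> 'I_(size b).+1}) N :
  is_composition b -> signed_flag h N ->
  sign (starred_of omega (mkf h N)) = (-1) ^+ #|N|.
Proof.
move=> bc sf; congr (_ ^+ _); apply: eq_card => x.
by rewrite inE neg_starred_mkf.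
Qed.

Lemma starred_mkf_inj b : is_composition b ->
  {in [pred p : {ffun P -> 'I_(size b).+1} * {set P} | signed_flag p.1 p.2] &,
    injective (fun p => starred_of omega (mkf p.1 p.2))}.
Proof.
move=> bc [h N] [h' N'] /= sf sf' E; congr pair.
  apply/ffunP => x; apply/ord_inj; apply: succn_inj.
  by rewrite -(abs_starred_mkf h N) E abs_starred_mkf.
by apply/setP => x; rewrite -(neg_starred_mkf x bc sf) E neg_starred_mkf.
Qed.

Lemma pointed_mkf b (h : {ffun P -> 'I_(size b).+1}) N :
  is_composition b -> signed_flag h N ->
  pointed_partition omega (starred_of omega (mkf h N)).
Proof.
move=> bc sf; have [h1 h2 h3 h4 h5] := signed_flagP sf; split.
  exists (mkf h N) => //; apply/enriched_mkf => //; rewrite h3.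
  exact/forallP.
move=> [|i] //=; rewrite max_abs_mkf// => ib.
have /exists_inP[z zi /andP[zN /forall_inP zu]] := h5 (Ordinal ib).
have zE : h z = i :> nat by move: zi; rewrite inE => /eqP.
exists z; split.
  rewrite (starred_mkf bc)// zE; have /eqP -> := zu z zi; by rewrite eqxx.
move=> x; rewrite (starred_mkf bc)//; case: ifP => // ax [xE].
have /= := zu x; rewrite xE in ax; rewrite inE xE eqxx ax => /(_ isT)/eqP/esym/eqP.
by [].
Qed.

Lemma enriched_mkfP f : enriched_partition omega f ->
  exists h : {ffun P -> 'I_(size (wt (starred_of omega f))).+1},
  [/\ is_composition (wt (starred_of omega f)),
      forall x, (h x < size (wt (starred_of omega f)))%N,
      forall j : 'I_(size (wt (starred_of omega f))),
        #|level h j| = nth 0%N (wt (starred_of omega f)) j &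
      f = mkf h (neg_set f)].
Proof.
move=> [f0 [k fk] _]; set g := starred_of omega f; set b := wt g.
have absE x : abs_starred (g x) = `|f x|%N by rewrite ffunE; case: ifP.
have fx0 x : (0 < `|f x|)%N by rewrite absz_gt0 f0.
have bk : size b = max_abs g by rewrite size_map size_iota.
have fle x : (`|f x| <= size b)%N.
  by rewrite bk -absE /max_abs (bigD1 x)//= leq_maxl.
pose h : {ffun P -> 'I_(size b).+1} := [ffun x => inord `|f x|.-1].
have hE x : (h x).+1 = `|f x|%N.
  by rewrite ffunE inordK ?prednK// leqW.
exists h; have hlt x : (h x < size b)%N by rewrite hE.
have sz j : (j < size b)%N -> nth 0%N b j = #|level h j|.
  move=> jb; rewrite bk in jb; rewrite (nth_map 0%N) ?size_iota// nth_iota//.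
  by apply: eq_card => x; rewrite !inE absE -hE add1n eqSS.
split=> //.
- apply/(all_nthP 0%N) => j jb; rewrite sz//; apply/card_gt0P.
  have bk' : (size b <= k)%N.
    rewrite bk; apply/bigmax_leqP => x _; rewrite absE.
    by have /andP[] : (1 <= `|f x| <= k)%N by apply/fk; exists x.
  have /fk[x xj] : (1 <= j.+1 <= k)%N by rewrite /= (leq_trans jb).
  by exists x; rewrite inE -eqSS hE xj.
- by move=> j; rewrite sz.
- apply/ffunP => x; rewrite ffunE inE hE; case: ltP => fx.
    by rewrite ltz0_abs// opprK.
  by rewrite gez0_abs.
Qed.

(** The underlying [f] may be negative at starred elements. Making these positive gives the set [N]
    required by [signed_flag], without changing the starred partition. *)
Lemma pointed_mkfP g : pointed_partition omega g ->
  is_composition (wt g) /\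
  exists (h : {ffun P -> 'I_(size (wt g)).+1}) N,
    signed_flag h N /\ g = starred_of omega (mkf h N).
Proof.
move=> [[f ef gE] gp]; have := enriched_mkfP ef; rewrite -gE.
set b := wt g => -[h [bc h1 h2 fE]]; split=> //; exists h.
set N0 := neg_set f in fE.
move: ef; rewrite fE enriched_mkf// => /andP[hm /forallP hv].
have gxE x : g x = if ambig (level h (h x)) N0 x then inr (h x).+1
                   else inl (mkf h N0 x).
  by rewrite gE fE (starred_mkf bc).
pose N := [set x | neg_starred (g x)]; exists N.
have NE x : (x \in N) = (x \in N0) && ~~ ambig (level h (h x)) N0 x.
  by rewrite inE gxE; case: ifP => ax; rewrite ?andbF// andbT /= mkf_lt0.
have gmax : max_abs g = size b by rewrite gE fE max_abs_mkf.
have sole (j : 'I_(size b)) : exists2 z, z \in level h j &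
    {in level h j, forall y, ambig (level h j) N0 y = (y == z)}.
  have [z [gz zu]] : exists! x, g x = inr j.+1.
    by apply: gp; rewrite gmax /= ltn_ord.
  move: gz; rewrite gxE; case: ifP => // az [zj].
  exists z; first by rewrite inE zj.
  move=> y; rewrite inE => /eqP yj; rewrite -yj; apply/idP/eqP => [ay|->].
    by apply/esym/zu; rewrite gxE ay yj.
  exact: az.
(* On each level, [N] agrees with [N0] or with its flip at the only ambiguous element [z]. *)
have NN0 (j : 'I_(size b)) : exists2 M : {set P}, {in level h j, N =i M} &
    valid (level h j) M /\
    {in level h j, forall y, ambig (level h j) M y = ambig (level h j) N0 y}.
  have [z zj zu] := sole j; have az : ambig (level h j) N0 z by rewrite zu ?eqxx.
  have NE' x : x \in level h j -> (x \in N) = (x \in N0) && (x != z).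
    by move=> xj; rewrite NE -zu//; move: xj; rewrite inE => /eqP ->.
  have [zN0|zN0] := boolP (z \in N0).
    exists (toggle N0 z); last by split=> // y yj; rewrite ambig_toggle.
    move=> x xj; rewrite NE'// in_toggle; case: eqVneq => [->|_]; last by rewrite andbT.
    by rewrite zN0 andbF.
  exists N0 => // x xj; rewrite NE'//; case: eqVneq => [->|_]; last by rewrite andbT.
  by rewrite (negbTE zN0).
have vN (j : 'I_(size b)) : valid (level h j) N.
  by have [M E [vM _]] := NN0 j; rewrite (eq_valid _ E).
have aN (j : 'I_(size b)) y : y \in level h j ->
    ambig (level h j) N y = ambig (level h j) N0 y.
  by move=> yj; have [M E [_ aM]] := NN0 j; rewrite (eq_ambig _ _ E) aM.
split.
  apply/andP; split.
    apply/and3P; split=> //; first exact/forallP.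
    by apply/forallP => j; rewrite h2.
  apply/forallP => j; rewrite vN /=; have [z zj zu] := sole j.
  apply/exists_inP; exists z => //; apply/andP; split.
    by rewrite NE negb_and negbK; move: (zu z zj); move: (zj); rewrite inE => /eqP ->; rewrite eqxx => ->; rewrite orbT.
  by apply/forall_inP => y yj; rewrite aN// zu.
apply/ffunP => x; rewrite (starred_mkf bc)// gxE.
have xl : x \in level h (Ordinal (h1 x)) by rewrite inE.
rewrite (aN _ x xl : ambig (level h (h x)) N x = _).
by case: ifP => //= ax; rewrite !ffunE NE ax andbT.
Qed.

(** The map [G] is a bijection from signed flags to pointed partitions of weight [b], by
    [starred_mkf_inj], [pointed_mkf] and [pointed_mkfP]. *)
Lemma sum_sign_wt b (L : seq {ffun P -> starred}) : is_composition b -> uniq L ->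
  (forall g, g \in L <-> pointed_partition omega g) ->
  \sum_(g <- L | wt g == b) sign g =
  (\prod_(n <- b) eta_mx omega n) (enum_rank set0) (enum_rank setT).
Proof.
move=> bc uL LP; rewrite prod_eta_flags//.
pose Q := [pred p : {ffun P -> 'I_(size b).+1} * {set P} | signed_flag p.1 p.2].
pose G (p : {ffun P -> 'I_(size b).+1} * {set P}) := starred_of omega (mkf p.1 p.2).
rewrite -big_filter (perm_big [seq G p | p <- enum Q]); last first.
  apply: uniq_perm; first exact: filter_uniq.
    rewrite map_inj_in_uniq ?enum_uniq// => p q; rewrite !mem_enum.
    exact: (starred_mkf_inj bc).
  move=> g; rewrite mem_filter; apply/andP/mapP => [[/eqP gb /LP gp]|].
    have [_ [h [N [sf ->]]]] := pointed_mkfP gp; subst b.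
    by exists (h, N) => //; rewrite mem_enum.
  move=> [[h N]]; rewrite mem_enum => sf ->; have [h1 h2 _ _ _] := signed_flagP sf.
  by split; [rewrite /G wt_mkf|apply/LP; exact: pointed_mkf].
rewrite big_map big_enum /=; apply: eq_bigr => -[h N] sf.
exact: sign_mkf.
Qed.

End EnrichedFlags.

(** * Coefficients of the power series *)

Section Coefficients.
Implicit Types (m : monomial) (b s : seq nat).

Definition supp m : seq nat := sort leq (finsupp m).
Definition exponents m : seq nat := [seq m i | i <- supp m].

Lemma mem_supp m i : (i \in supp m) = (m i != 0%N).
Proof. by rewrite mem_sort mem_finsupp. Qed.

Lemma supp_sorted m : sorted ltn (supp m).
Proof.
by rewrite ltn_sorted_uniq_leq sort_uniq fset_uniq sort_sorted//; exact: leq_total.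
Qed.

Lemma supp_uniq m : uniq (supp m).
Proof. by rewrite sort_uniq fset_uniq. Qed.

Lemma exponents_comp m : is_composition (exponents m).
Proof. by apply/allP => _ /mapP[i im ->] /=; rewrite lt0n -mem_supp. Qed.

Lemma gen_series_size (T : choiceType) (A : set T) (e : T -> monomial) m
    (L : seq T) : uniq L -> (forall t, t \in L <-> A t /\ e t = m) ->
  gen_series A e m = (size L)%:R.
Proof.
move=> uL LP; transitivity (\sum_(t <- L) 1 : rat); last first.
  by rewrite big_const_seq count_predT iter_addr_0.
rewrite fsbig_seq//; apply/esym; rewrite /gen_series.
transitivity (\sum_(t \in [set` L]) ((e t == m)%:R : rat)).
  by apply: eq_fsbigr => t /set_mem/LP[_ ->]; rewrite eqxx.
apply: fsbig_widen => [t /= /LP[]//|t /= [At nL]].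
by case: eqP => // et; case: nL; apply/LP.
Qed.

Lemma monom_of_index b s i : uniq s -> size s = size b ->
  monom_of b s i = if i \in s then nth 0%N b (index i s) else 0%N.
Proof.
rewrite monom_ofE; elim: s b => [|j s IH] [|n b] //=; first by rewrite big_nil.
move=> /andP[js us] [sb]; rewrite big_cons /= (IH b us sb) in_cons [i == j]eq_sym.
by have [E|_] //= := eqVneq j i; rewrite -E (negbTE js) addn0.
Qed.

(** The only sequence that can produce [m] is its sorted support. The condition at 0 appears because
    variables start at index 1. *)
Lemma monomial_qsymE b m : is_composition b ->
  monomial_qsym b m = ((m 0%N == 0%N) && (b == exponents m))%:R.
Proof.
move=> bc; pose L := if (m 0%N == 0%N) && (b == exponents m) then [:: supp m] else [::].
rewrite /monomial_qsym (@gen_series_size _ _ _ _ L); first by rewrite /L; case: ifP.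
  by rewrite /L; case: ifP.
move=> s; rewrite /L; split.
  case: ifP => // /andP[/eqP m0 /eqP bE]; rewrite mem_seq1 => /eqP ->.
  have sz : size (supp m) = size b by rewrite bE size_map.
  split; first split=> //; first split; first exact: supp_sorted.
    apply/allP => i; rewrite mem_supp lt0n; by apply: contra => /eqP ->; rewrite m0.
  apply/fsfunP => i; rewrite monom_of_index ?supp_uniq//; case: ifP => si.
    by rewrite bE (nth_map 0%N) ?index_mem// nth_index.
  by apply/esym/eqP; rewrite -[_ == _]negbK -mem_supp si.
move=> [[sb [ss /allP sp]] sm].
have us : uniq s by move: ss; rewrite ltn_sorted_uniq_leq => /andP[].
have mE i : m i = if i \in s then nth 0%N b (index i s) else 0%N.
  by rewrite -sm monom_of_index.
have sE : s = supp m.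
  apply: (irr_sorted_eq ltn_trans ltnn) => //; first exact: supp_sorted.
  move=> i; rewrite mem_supp mE; case: ifP => // si; apply/esym.
  by rewrite -lt0n; move/allP: bc; apply; apply: mem_nth; rewrite -sb index_mem.
have bE : b = exponents m.
  rewrite /exponents -sE; apply: (@eq_from_nth _ 0%N); first by rewrite size_map.
  move=> j jb; rewrite (nth_map 0%N) ?sb// mE mem_nth ?sb// index_uniq ?sb//.
have -> : m 0%N = 0%N by rewrite mE; case: ifPn => // /sp.
by rewrite -bE !eqxx /= sE mem_head.
Qed.

(** At [m] only the coarsening [exponents m] contributes, and at most one cut of [a] has these block
    sums; both sides have at most one nonzero term. *)
Lemma psiE a m : is_composition a -> psi a m =
  if m 0%N == 0%N then
    \sum_(bl <- blockings (exponents m)) (flatten bl == a)%:R * blocking_weight bl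
  else 0.
Proof.
move=> ac; rewrite /psi fsbig_finite; last exact: finite_coarsenings.
rewrite fct_sumE; set S := fset_set _.
have SP b : reflect (coarsening a b) (b \in S).
  rewrite in_fset_set; last exact: finite_coarsenings.
  by apply: (iffP idP) => [/set_mem|cb]; last exact: mem_set.
transitivity (\sum_(b <- S) (if (m 0%N == 0%N) && (b == exponents m) then
    (pi_pair a b)%:R^-1 else 0) : rat).
  apply: eq_big_seq => b /SP cb; rewrite scalrfctE monomial_qsymE; last first.
    exact: coarsening_composition cb.
  by case: ifP => _; rewrite /GRing.scale /= ?mulr1 ?mulr0.
case: eqP => /= [m0|_]; last by rewrite big1.
set b := exponents m; have bc : is_composition b := exponents_comp m.
(* The blocks are read off from partial sums; they are nonempty because the parts of [b] are
   positive. *)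
have blE bl : bl \in blockings b -> flatten bl = a ->
    bl = [seq block a b i | i <- iota 0 (size b)].
  rewrite mem_blockings => /andP[bb /eqP be] fa.
  rewrite -[LHS](blocks_coarsening ac _ fa) ?be; first by rewrite -be size_map.
  apply/allP => c cbl; apply/negP => /eqP c0.
  have : 0%N \in b by rewrite -be; apply/mapP; exists c => //; rewrite c0.
  by move/allP: bc => bc /bc.
have [/SP[bl [ne fa be]]|nS] := boolP (b \in S).
  have blb : bl \in blockings b.
    rewrite mem_blockings be eqxx andbT; apply/allP => c cbl; apply/allP => i ic.
    by move/allP: ac; apply; rewrite -fa; apply/flattenP; exists c.
  rewrite (bigD1_seq b) ?fset_uniq//=; last by apply/SP; exists bl.
  rewrite eqxx big1 ?addr0 => [|c /negbTE ->//].
  rewrite (bigD1_seq bl) ?blockings_uniq//= fa eqxx mul1r.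
  rewrite big_seq_cond big1 ?addr0 => [|bl' /andP[bl'b nbl]]; last first.
    case: eqP => [fa'|_]; last by rewrite mul0r.
    by rewrite (blE _ bl'b fa') -(blE _ blb fa) eqxx in nbl.
  rewrite (blE _ blb fa) /blocking_weight big_map /pi_pair natr_prod prodfV.
  by rewrite /index_iota subn0.
rewrite big_seq_cond big1 => [|c /andP[cS _]]; last first.
  by case: eqP => // cb; rewrite -cb cS in nS.
rewrite big_seq_cond big1// => bl /andP[blb _]; case: eqP => [fa|_]; last by rewrite mul0r.
case/SP: nS; exists bl; move: (blb); rewrite mem_blockings => /andP[bb /eqP be]; split=> //.
apply/allP => c cbl; apply/negP => /eqP c0.
have : 0%N \in b by rewrite -be; apply/mapP; exists c => //; rewrite c0.
by move/allP: bc => bc /bc.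
Qed.

Variables (d : Order.disp_t) (P : finPOrderType d) (omega : P -> 'I_#|P|).
Hypothesis omega_inj : injective omega.

(** A partition with content [m] is determined by the ranks of its values in [supp m]. The ranks
    form a flag with sizes [exponents m], and strictness at descents says that [omega] increases on
    each level. *)
Lemma KP_coef m : KP omega m =
  if m 0%N == 0%N then
    (\prod_(n <- exponents m) zeta_mx omega n) (enum_rank set0) (enum_rank setT)
  else 0.
Proof.
have suppP (theta : {ffun P -> nat}) x : content theta = m -> theta x \in supp m.
  move=> <-; rewrite mem_supp contentE -lt0n; apply/card_gt0P; exists x.
  by rewrite inE.
case: eqP => [m0|m0]; last first.
  (* All values are positive, so no content involves the index 0. *)
  rewrite /KP (@gen_series_size _ _ _ _ [::])// => theta; split=> // -[[tp _] tm].
  case: m0; rewrite -tm contentE; apply/eqP; rewrite cards_eq0; apply/eqP/setP => x.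
  by rewrite !inE; apply/negbTE; rewrite -lt0n.
rewrite prod_zeta_flags; set b := exponents m; set s := supp m.
have sb : size s = size b by rewrite size_map.
pose Q := [pred h : {ffun P -> 'I_(size b).+1} | flag h &&
             [forall j : 'I_(size b), valid omega (level h j) set0]].
pose theta (h : {ffun P -> 'I_(size b).+1}) : {ffun P -> nat} :=
  [ffun x => nth 0%N s (h x)].
have us : uniq s := supp_uniq m.
rewrite /KP (@gen_series_size _ _ _ _ [seq theta h | h <- enum Q]).
- rewrite size_map -cardE -sum1_card natr_sum big_mkcondr /=.
  by apply: eq_bigr => h _; case: ifP.
- rewrite map_inj_in_uniq ?enum_uniq// => h h'; rewrite !mem_enum.
  move=> /andP[/and3P[/forallP hk _ _] _] /andP[/and3P[/forallP hk' _ _] _] /ffunP E.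
  apply/ffunP => x; apply/ord_inj/eqP; have := E x; rewrite !ffunE => /eqP.
  by rewrite nth_uniq// sb.
have nth_lt := sorted_ltn_nth ltn_trans 0%N (supp_sorted m).
have nth_inS j : (j < size b)%N -> nth 0%N s j \in s by move=> jb; rewrite mem_nth ?sb.
move=> t; split.
  move=> /mapP[h]; rewrite mem_enum.
  move=> /andP[/and3P[/forallP hk /monotoneP hm /forallP hs] /forallP hv] ->.
  split.
    split=> [x|x y xy]; rewrite !ffunE.
      rewrite lt0n; apply/negP => /eqP x0.
      by have := nth_inS _ (hk x); rewrite x0 mem_supp m0.
    have := hm x y xy; rewrite leq_eqVlt => /orP[/eqP E|lt]; last first.
      have lt' : (nth 0 s (h x) < nth 0 s (h y))%N by apply: nth_lt; rewrite ?inE ?sb.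
      by rewrite (ltnW lt') lt'.
    rewrite E leqnn; split=> // yx; move: xy; rewrite le_eqVlt => /orP[/eqP xy|xy].
      by rewrite xy ltnn in yx.
    have /validP/(_ x y) := hv (Ordinal (hk x)).
    rewrite /step !inE /= E eqxx => /(_ isT isT xy) lt.
    by rewrite ltnNge (ltnW lt) in yx.
  apply/fsfunP => i; rewrite contentE; have [si|ni] := boolP (i \in s).
    have jb : (index i s < size b)%N by rewrite -sb index_mem.
    transitivity #|level h (Ordinal jb)|.
      apply: eq_card => x; rewrite !inE ffunE /= -{1}(nth_index 0%N si).
      by rewrite nth_uniq// ?sb// ?index_mem.
    by rewrite (eqP (hs _)) /= (nth_map 0%N) ?index_mem// nth_index.
  move: (ni); rewrite mem_supp negbK => /eqP ->; apply/eqP; rewrite cards_eq0.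
  apply/eqP/setP => x; rewrite !inE ffunE; apply/negP => /eqP E.
  by rewrite -E nth_inS in ni.
move=> [[tp tle] tm]; apply/mapP.
have ts x : t x \in s by exact: suppP.
pose h : {ffun P -> 'I_(size b).+1} := [ffun x => inord (index (t x) s)].
have hE x : h x = index (t x) s :> nat.
  by rewrite ffunE inordK// ltnS -sb ltnW// index_mem.
have hk x : (h x < size b)%N by rewrite hE -sb index_mem.
have thE x : t x = nth 0%N s (h x) by rewrite hE nth_index.
have hlt x y : (t x < t y)%N -> (h x < h y)%N.
  rewrite !thE; case: (ltngtP (h x) (h y)) => // [lt|->]; last by rewrite ltnn.
  have lt' : (nth 0 s (h y) < nth 0 s (h x))%N by apply: nth_lt; rewrite ?inE ?sb.
  by move=> /(ltn_trans lt'); rewrite ltnn.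
exists h; last by apply/ffunP => x; rewrite ffunE thE.
rewrite mem_enum inE; apply/andP; split.
  apply/and3P; split; first exact/forallP.
    apply/monotoneP => x y /tle[]; rewrite leq_eqVlt => /orP[/eqP E|/hlt/ltnW//].
    by rewrite !hE E.
  apply/forallP => j; apply/eqP; rewrite (nth_map 0%N) ?sb// -/s.
  have -> i : m i = #|[set x | t x == i]| by rewrite -tm contentE.
  apply: eq_card => x; rewrite !inE thE nth_uniq// sb//.
apply/forallP => j; apply/validP => x y; rewrite !inE => /eqP xj /eqP yj xy.
rewrite /step !inE /= ltnNge; apply/negP => yx.
move: yx; rewrite leq_eqVlt => /orP[/eqP/val_inj/omega_inj E|yx].
  by rewrite E ltxx in xy.
by have [_ /(_ yx)/hlt] := tle x y (ltW xy); rewrite xj yj ltnn.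
Qed.

End Coefficients.

(** * Comparison of coefficients *)

Local Open Scope classical_set_scope.

Theorem theorem6p9 (d : Order.disp_t) (P : finPOrderType d)
    (omega : P -> 'I_#|P|) (omega_bij : bijective omega) :
  KP omega =
  \sum_(g \in [set g : {ffun P -> starred} | pointed_partition omega g])
    sign g *: psi (wt g).
Proof.
have omega_inj := bij_inj omega_bij; apply/funext => m; rewrite KP_coef//.
rewrite fsbig_finite; last exact: finite_pointed.
rewrite fct_sumE; set L := fset_set _.
have LP g : g \in L <-> pointed_partition omega g.
  rewrite in_fset_set; last exact: finite_pointed.
  by split=> [/set_mem|?]; last exact: mem_set.
under [RHS]eq_big_seq => g gL.
  rewrite scalrfctE psiE; last by have [] := pointed_mkfP omega_inj (proj1 (LP g) gL).
  over.
case: eqP => [m0|_]; last by rewrite big1// => g _; exact: mulr0.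
(* The left side becomes a sum over blockings of [exponents m]; exchanging sums gives the right side
   the same shape. *)
rewrite (newton_expansion_prod (zeta_mx0 omega) (zeta_mx_newton omega_inj)).
rewrite summxE; under [RHS]eq_bigr do rewrite /GRing.scale /= mulr_sumr.
rewrite exchange_big /=; apply: eq_big_seq => bl.
rewrite mem_blockings => /andP[/allP bb _]; rewrite mxE.
(* For a fixed blocking, the product of the [eta_mx] is the signed number of pointed partitions of
   weight [flatten bl]. *)
rewrite -(@sum_sign_wt _ _ _ omega_inj _ L) ?fset_uniq//; last first.
  by apply/allP => i /flattenP[c /bb/allP]; exact.
rewrite big_mkcond mulr_sumr /=; apply: eq_bigr => g _.
by rewrite eq_sym; case: eqP => _; rewrite ?mul0r ?mulr0 ?mul1r 1?mulrC.
Qed.
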